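(* There exists an assignment, to each constant $c$ of $\mathsf{HA}^\omega$ of type $\sigma$ (at each type instance), of a closed $\mathsf{HA}^\omega$-term $c^\alpha$ of type $\sigma^+$, such that the following holds. Fix an injective assignment of a variable $x^\alpha$ of type $\sigma^+$ to each variable $x$ of type $\sigma$, and define the $\alpha$-translation of terms by $x^\alpha := x^\alpha$, $c^\alpha := c^\alpha$, $(st)^\alpha := s^\alpha * t^\alpha$, and of formulas of $\mathsf{H}\text{-}\mathsf{HA}^\omega$ by $(\mathrm{Ext}_\sigma(t))^\alpha := \mathrm{dom}_\sigma(t^\alpha)$; $(s\equiv_\sigma t)^\alpha := s^\alpha \equiv_{\sigma^+} t^\alpha$; $(s =_\sigma t)^\alpha := \neg\exists z:\sigma^-.\,\mathrm{app}_\sigma(s^\alpha,t^\alpha,z)$; $\bot^\alpha := \bot$; $(\varphi\,\square\,\psi)^\alpha := \varphi^\alpha\,\square\,\psi^\alpha$ for $\square\in\{\wedge,\vee,\to\}$; $(\exists x:\sigma.\varphi)^\alpha := \exists x^\alpha:\sigma^+.\varphi^\alpha$; $(\forall x:\sigma.\varphi)^\alpha := \forall x^\alpha:\sigma^+.\varphi^\alpha$. Then for every formula $\varphi$ of the language of $\mathsf{H}\text{-}\mathsf{HA}^\omega$: if $\mathsf{HE}\text{-}\mathsf{HA}^\omega \vdash \varphi$, then $\mathsf{HA}^\omega \vdash \varphi^\alpha$.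
   Context: Finite types are generated by: $0$ is a type; if $\sigma,\tau$ are types, so are $\sigma\times\tau$ and $\sigma\to\tau$ ($\to$ associates to the right). $\mathsf{HA}^\omega$ is the many-sorted intuitionistic first-order theory whose sorts are the finite types. Its terms are built from variables of each type and, for all types $\rho,\sigma,\tau$, the constants $\mathsf{k}:\rho\to\sigma\to\rho$, $\mathsf{s}:(\rho\to\sigma\to\tau)\to(\rho\to\sigma)\to(\rho\to\tau)$, $\mathsf{pair}:\sigma\to\tau\to\sigma\times\tau$, $\mathsf{fst}:\sigma\times\tau\to\sigma$, $\mathsf{snd}:\sigma\times\tau\to\tau$, $0:0$, $S:0\to0$, $\mathsf{R}:\sigma\to(0\to\sigma\to\sigma)\to0\to\sigma$, by application (if $s:\sigma\to\tau$, $t:\sigma$ then $st:\tau$; application associates to the left). Atomic formulas are $\bot$ and $s\equiv_\sigma t$; $\neg\varphi$ abbreviates $\varphi\to\bot$. Axioms: $\equiv_\sigma$ is reflexive, symmetric and transitive; $x\equiv x'\to y\equiv y'\to xy\equiv x'y'$; $\mathsf{k}xy\equiv x$; $\mathsf{s}xyz\equiv xz(yz)$; $\mathsf{fst}(\mathsf{pair}\,xy)\equiv x$; $\mathsf{snd}(\mathsf{pair}\,xy)\equiv y$; $\mathsf{R}xy0\equiv x$; $\mathsf{R}xy(Sm)\equiv ym(\mathsf{R}xym)$; $Sx\equiv_0Sy\to x\equiv_0y$; $\neg(Sx\equiv_0 0)$; induction $\varphi(0)\to\forall x:0(\varphi(x)\to\varphi(Sx))\to\forall x:0\,\varphi(x)$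 for all formulas. Surjective pairing is not assumed. $\mathsf{H}\text{-}\mathsf{HA}^\omega$ extends the language with, for each type $\sigma$, a unary predicate $\mathrm{Ext}_\sigma$ and a binary predicate $=_\sigma$. Its axioms are those of $\mathsf{HA}^\omega$, induction for all formulas of the extended language, and for all $\sigma,\tau$: $x=_0y\leftrightarrow x\equiv_0y$; $\forall x:0\,\mathrm{Ext}_0(x)$; $x=_{\sigma\times\tau}y\leftrightarrow(\mathsf{fst}\,x=_\sigma\mathsf{fst}\,y\wedge\mathsf{snd}\,x=_\tau\mathsf{snd}\,y)$; $\mathrm{Ext}_{\sigma\times\tau}(x)\leftrightarrow(\mathrm{Ext}_\sigma(\mathsf{fst}\,x)\wedge\mathrm{Ext}_\tau(\mathsf{snd}\,x))$; $f=_{\sigma\to\tau}g\leftrightarrow\forall x:\sigma(\mathrm{Ext}_\sigma(x)\to fx=_\tau gx)$; $\mathrm{Ext}_{\sigma\to\tau}(f)\to\mathrm{Ext}_\sigma(x)\to\mathrm{Ext}_\tau(fx)$; $x\equiv_\sigma y\to\mathrm{Ext}_\sigma(x)\to\mathrm{Ext}_\sigma(y)$; $\mathrm{Ext}(c)$ for each constant $c$. $\mathsf{HE}\text{-}\mathsf{HA}^\omega$ is $\mathsf{H}\text{-}\mathsf{HA}^\omega$ plus, for all $\sigma,\tau$, the axiom $\mathrm{Ext}_{\sigma\to\tau}(f)\to\mathrm{Ext}_\sigma(x)\to\mathrm{Ext}_\sigma(y)\to x=_\sigma y\to fx=_\tau fy$. Auxiliary types and $\mathsf{HA}^\omega$-formulas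 (by induction on $\sigma$; $\mathrm{dom}_\sigma$ has a free variable $x:\sigma^+$, $\mathrm{app}_\sigma$ free variables $x,y:\sigma^+$, $z:\sigma^-$): $0^+:=0$, $0^-:=0$, $\mathrm{dom}_0(x):=\top$, $\mathrm{app}_0(x,y,z):=\neg(x\equiv_0y)$. $(\sigma\times\tau)^+:=\sigma^+\times\tau^+$, $(\sigma\times\tau)^-:=(\sigma^-\times\tau^-)\times0$, $\mathrm{dom}_{\sigma\times\tau}(x):=\mathrm{dom}_\sigma(\mathsf{fst}\,x)\wedge\mathrm{dom}_\tau(\mathsf{snd}\,x)$, $\mathrm{app}_{\sigma\times\tau}(x,y,z):=(\mathsf{snd}\,z\equiv_00\to\mathrm{app}_\sigma(\mathsf{fst}\,x,\mathsf{fst}\,y,\mathsf{fst}(\mathsf{fst}\,z)))\wedge(\neg(\mathsf{snd}\,z\equiv_00)\to\mathrm{app}_\tau(\mathsf{snd}\,x,\mathsf{snd}\,y,\mathsf{snd}(\mathsf{fst}\,z)))$. $(\sigma\to\tau)^+:=(\sigma^+\to\tau^+)\times(\sigma^+\to\sigma^+\to\tau^-\to\sigma^-)$, $(\sigma\to\tau)^-:=\sigma^+\times\tau^-$; for $s:(\sigma\to\tau)^+$, $t:\sigma^+$ write $s*t:=(\mathsf{fst}\,s)t:\tau^+$ ($*$ associates to the left); $\mathrm{dom}_{\sigma\to\tau}(x):=\forall u:\sigma^+(\mathrm{dom}_\sigma(u)\to\mathrm{dom}_\tau(x*u))\wedge\forall u,v:\sigma^+\forall w:\tau^-(\mathrm{dom}_\sigma(u)\to\mathrm{dom}_\sigma(v)\to\mathrm{app}_\tau(x*u,x*v,w)\to\mathrm{app}_\sigma(u,v,(\mathsf{snd}\,x)uvw))$;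 $\mathrm{app}_{\sigma\to\tau}(x,y,z):=\mathrm{dom}_\sigma(\mathsf{fst}\,z)\wedge\mathrm{app}_\tau(x*(\mathsf{fst}\,z),y*(\mathsf{fst}\,z),\mathsf{snd}\,z)$. *)

(* Defs.v *)
From Stdlib Require Import List.

Set Implicit Arguments.
Unset Strict Implicit.
Unset Printing Implicit Defensive.

Inductive ty : Type :=
| O : ty
| Prod : ty -> ty -> ty
| Arr : ty -> ty -> ty.

Declare Scope ty_scope.
Delimit Scope ty_scope with ty.
Bind Scope ty_scope with ty.
Notation "a ** b" := (Prod a b) (at level 40, left associativity) : ty_scope.
Notation "a ~> b" := (Arr a b) (at level 60, right associativity) : ty_scope.
Local Open Scope ty_scope.

(* Syntax is intrinsically typed, with de Bruijn indices: a context lists the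
   types of the variables in scope, and [var G a] is the type of the variables
   of type [a] in [G].  Every type has a closed term, so derivability in a
   context agrees with derivability over an unrestricted supply of variables. *)
Definition ctx : Type := list ty.

Inductive var : ctx -> ty -> Type :=
| v0 : forall G a, var (a :: G) a
| vS : forall G a b, var G a -> var (b :: G) a.
Arguments v0 {G a}.
Arguments vS {G a b} _.

Inductive const : ty -> Type :=
| cK : forall r s, const (r ~> s ~> r)
| cS : forall r s t, const ((r ~> s ~> t) ~> (r ~> s) ~> (r ~> t))
| cPair : forall s t, const (s ~> t ~> s ** t)
| cFst : forall s t, const (s ** t ~> s)
| cSnd : forall s t, const (s ** t ~> t)
| cZero : const O
| cSucc : const (O ~> O)
| cRec : forall s, const (s ~> (O ~> s ~> s) ~> O ~> s).

Inductive tm (G : ctx) : ty -> Type :=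
| Var : forall a, var G a -> tm G a
| Cst : forall a, const a -> tm G a
| App : forall a b, tm G (a ~> b) -> tm G a -> tm G b.
Arguments Var {G a} _.
Arguments Cst {G a} _.

Declare Scope tm_scope.
Delimit Scope tm_scope with tm.
Bind Scope tm_scope with tm.
Notation "s @ t" := (App s t) (at level 40, left associativity) : tm_scope.
Local Open Scope tm_scope.

Definition tk {G} r s : tm G _ := Cst (cK r s).
Definition ts {G} r s t : tm G _ := Cst (cS r s t).
Definition tpair {G s t} (x : tm G s) (y : tm G t) : tm G (s ** t) :=
  Cst (cPair s t) @ x @ y.
Definition tfst {G s t} (p : tm G (s ** t)) : tm G s := Cst (cFst s t) @ p.
Definition tsnd {G s t} (p : tm G (s ** t)) : tm G t := Cst (cSnd s t) @ p.
Definition tzero {G} : tm G O := Cst cZero.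
Definition tsucc {G} (n : tm G O) : tm G O := Cst cSucc @ n.
Definition trec {G} s : tm G _ := Cst (cRec s).

(* [LHA] is the language of HA^omega; [LH] adds the predicates Ext and =. *)
Inductive lang : Type := LHA | LH.
Definition has_ext (L : lang) : Prop :=
  match L with LHA => False | LH => True end.

Inductive fm (L : lang) (G : ctx) : Type :=
| Bot : fm L G
| Eqv : forall a, tm G a -> tm G a -> fm L G
| ExtAt : has_ext L -> forall a, tm G a -> fm L G
| HeqAt : has_ext L -> forall a, tm G a -> tm G a -> fm L G
| And : fm L G -> fm L G -> fm L G
| Or : fm L G -> fm L G -> fm L G
| Imp : fm L G -> fm L G -> fm L G
| All : forall a, fm L (a :: G) -> fm L G
| Ex : forall a, fm L (a :: G) -> fm L G.
Arguments Bot {L G}.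
Arguments Eqv {L G a} _ _.
Arguments All {L G} a _.
Arguments Ex {L G} a _.

Definition Ext {G a} (t : tm G a) : fm LH G := ExtAt (L := LH) I t.
Definition Heq {G a} (s t : tm G a) : fm LH G := HeqAt (L := LH) I s t.

Declare Scope fm_scope.
Delimit Scope fm_scope with fm.
Bind Scope fm_scope with fm.
Notation "s == t" := (Eqv s%tm t%tm) (at level 70, no associativity) : fm_scope.
Notation "s =e t" := (Heq s%tm t%tm) (at level 70, no associativity) : fm_scope.
Notation "p && q" := (And p q) (at level 40, left associativity) : fm_scope.
Notation "p ==> q" := (Imp p q) (at level 75, right associativity) : fm_scope.
Local Open Scope fm_scope.

Definition Not {L G} (p : fm L G) : fm L G := p ==> Bot.
Definition Top {L G} : fm L G := Bot ==> Bot.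
Definition Iff {L G} (p q : fm L G) : fm L G := (p ==> q) && (q ==> p).

(* Case analysis on a variable of an extended context. *)
Definition vcase {G b} (P : ty -> Type) (h : P b) (t : forall a, var G a -> P a)
    a (x : var (b :: G) a) : P a :=
  match x in var G' a'
    return match G' with
           | nil => unit
           | b' :: G'' => P b' -> (forall c, var G'' c -> P c) -> P a'
           end
  with
  | v0 => fun h _ => h
  | vS y => fun _ t => t _ y
  end h t.

Definition ren (G D : ctx) : Type := forall a, var G a -> var D a.
Definition sub (G D : ctx) : Type := forall a, var G a -> tm D a.

Definition up_ren {G D} b (r : ren G D) : ren (b :: G) (b :: D) :=
  vcase (P := var (b :: D)) v0 (fun _ x => vS (r _ x)).

Definition shift {G} b : ren G (b :: G) := fun _ x => vS x.

Definition ren_nil {G} : ren nil G :=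
  fun a x => match x in var G' _ return match G' with nil => var G a | _ => unit end
             with v0 => tt | vS _ => tt end.

Fixpoint ren_tm {G D} (r : ren G D) a (t : tm G a) : tm D a :=
  match t with
  | Var x => Var (r _ x)
  | Cst c => Cst c
  | App s t => ren_tm r s @ ren_tm r t
  end.

Fixpoint ren_fm {L G D} (r : ren G D) (p : fm L G) : fm L D :=
  match p with
  | Bot => Bot
  | Eqv s t => Eqv (ren_tm r s) (ren_tm r t)
  | ExtAt e t => ExtAt e (ren_tm r t)
  | HeqAt e s t => HeqAt e (ren_tm r s) (ren_tm r t)
  | And p q => And (ren_fm r p) (ren_fm r q)
  | Or p q => Or (ren_fm r p) (ren_fm r q)
  | Imp p q => Imp (ren_fm r p) (ren_fm r q)
  | All a p => All a (ren_fm (up_ren r) p)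
  | Ex a p => Ex a (ren_fm (up_ren r) p)
  end.

Definition wk {G b a} (t : tm G a) : tm (b :: G) a := ren_tm (shift b) t.
Definition wkf {L G b} (p : fm L G) : fm L (b :: G) := ren_fm (shift b) p.
Definition closed {G a} (t : tm nil a) : tm G a := ren_tm ren_nil t.

Definition up_sub {G D} b (s : sub G D) : sub (b :: G) (b :: D) :=
  vcase (P := tm (b :: D)) (Var v0) (fun _ x => wk (s _ x)).

Fixpoint sub_tm {G D} (s : sub G D) a (t : tm G a) : tm D a :=
  match t with
  | Var x => s _ x
  | Cst c => Cst c
  | App t u => sub_tm s t @ sub_tm s u
  end.

Fixpoint sub_fm {L G D} (s : sub G D) (p : fm L G) : fm L D :=
  match p with
  | Bot => Bot
  | Eqv t u => Eqv (sub_tm s t) (sub_tm s u)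
  | ExtAt e t => ExtAt e (sub_tm s t)
  | HeqAt e t u => HeqAt e (sub_tm s t) (sub_tm s u)
  | And p q => And (sub_fm s p) (sub_fm s q)
  | Or p q => Or (sub_fm s p) (sub_fm s q)
  | Imp p q => Imp (sub_fm s p) (sub_fm s q)
  | All a p => All a (sub_fm (up_sub s) p)
  | Ex a p => Ex a (sub_fm (up_sub s) p)
  end.

Definition inst {L G b} (p : fm L (b :: G)) (t : tm G b) : fm L G :=
  sub_fm (vcase (P := tm G) t (fun _ x => Var x)) p.

(* phi(x) |-> phi(S x), both in the context extended by x. *)
Definition succ_inst {L G} (p : fm L (O :: G)) : fm L (O :: G) :=
  sub_fm (vcase (P := tm (O :: G)) (tsucc (Var v0)) (fun _ x => Var (vS x))) p.

(* Intuitionistic natural deduction over a family of axioms [Ax]; the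
   individual variables of [H |- p] range over the context [G]. *)
Inductive prv (L : lang) (Ax : forall G, fm L G -> Prop) (G : ctx)
    (H : list (fm L G)) : fm L G -> Prop :=
| prv_ax : forall p, Ax G p -> prv Ax H p
| prv_hyp : forall p, In p H -> prv Ax H p
| prv_botE : forall p, prv Ax H Bot -> prv Ax H p
| prv_andI : forall p q, prv Ax H p -> prv Ax H q -> prv Ax H (And p q)
| prv_andE1 : forall p q, prv Ax H (And p q) -> prv Ax H p
| prv_andE2 : forall p q, prv Ax H (And p q) -> prv Ax H q
| prv_orI1 : forall p q, prv Ax H p -> prv Ax H (Or p q)
| prv_orI2 : forall p q, prv Ax H q -> prv Ax H (Or p q)
| prv_orE : forall p q r, prv Ax H (Or p q) ->
    prv Ax (p :: H) r -> prv Ax (q :: H) r -> prv Ax H r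
| prv_impI : forall p q, prv Ax (p :: H) q -> prv Ax H (Imp p q)
| prv_impE : forall p q, prv Ax H (Imp p q) -> prv Ax H p -> prv Ax H q
| prv_allI : forall a (p : fm L (a :: G)),
    prv Ax (map wkf H) p -> prv Ax H (All a p)
| prv_allE : forall a (p : fm L (a :: G)) (t : tm G a),
    prv Ax H (All a p) -> prv Ax H (inst p t)
| prv_exI : forall a (p : fm L (a :: G)) (t : tm G a),
    prv Ax H (inst p t) -> prv Ax H (Ex a p)
| prv_exE : forall a (p : fm L (a :: G)) (q : fm L G),
    prv Ax H (Ex a p) -> prv Ax (p :: map wkf H) (wkf q) -> prv Ax H q.

(* The free variables of an axiom are read universally: each axiom is given by
   all its instances with terms for these variables. *)
Inductive HA_ax (L : lang) (G : ctx) : fm L G -> Prop :=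
| ax_refl : forall a (x : tm G a), HA_ax (x == x)
| ax_sym : forall a (x y : tm G a), HA_ax (x == y ==> y == x)
| ax_trans : forall a (x y z : tm G a), HA_ax (x == y ==> y == z ==> x == z)
| ax_app : forall a b (x x' : tm G (a ~> b)) (y y' : tm G a),
    HA_ax (x == x' ==> y == y' ==> x @ y == x' @ y')
| ax_k : forall r s (x : tm G r) (y : tm G s), HA_ax (tk r s @ x @ y == x)
| ax_s : forall r s t (x : tm G (r ~> s ~> t)) (y : tm G (r ~> s)) (z : tm G r),
    HA_ax (ts r s t @ x @ y @ z == x @ z @ (y @ z))
| ax_fst : forall s t (x : tm G s) (y : tm G t), HA_ax (tfst (tpair x y) == x)
| ax_snd : forall s t (x : tm G s) (y : tm G t), HA_ax (tsnd (tpair x y) == y)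
| ax_rec0 : forall s (x : tm G s) (y : tm G (O ~> s ~> s)),
    HA_ax (trec s @ x @ y @ tzero == x)
| ax_recS : forall s (x : tm G s) (y : tm G (O ~> s ~> s)) (m : tm G O),
    HA_ax (trec s @ x @ y @ tsucc m == y @ m @ (trec s @ x @ y @ m))
| ax_succ_inj : forall x y : tm G O, HA_ax (tsucc x == tsucc y ==> x == y)
| ax_succ_neq0 : forall x : tm G O, HA_ax (Not (tsucc x == tzero))
| ax_ind : forall p : fm L (O :: G),
    HA_ax (inst p tzero ==> All O (p ==> succ_inst p) ==> All O p).

Inductive H_ax (G : ctx) : fm LH G -> Prop :=
| H_HA : forall p, HA_ax p -> H_ax p
| H_eq0 : forall x y : tm G O, H_ax (Iff (x =e y) (x == y))
| H_ext0 : H_ax (All O (Ext (Var v0)))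
| H_eq_prod : forall a b (x y : tm G (a ** b)),
    H_ax (Iff (x =e y) ((tfst x =e tfst y) && (tsnd x =e tsnd y)))
| H_ext_prod : forall a b (x : tm G (a ** b)),
    H_ax (Iff (Ext x) (Ext (tfst x) && Ext (tsnd x)))
| H_eq_arr : forall a b (f g : tm G (a ~> b)),
    H_ax (Iff (f =e g)
              (All a (Ext (Var v0) ==> wk f @ Var v0 =e wk g @ Var v0)))
| H_ext_arr : forall a b (f : tm G (a ~> b)) (x : tm G a),
    H_ax (Ext f ==> Ext x ==> Ext (f @ x))
| H_ext_eqv : forall a (x y : tm G a), H_ax (x == y ==> Ext x ==> Ext y)
| H_ext_const : forall a (c : const a), H_ax (Ext (Cst c)).

Inductive HE_ax (G : ctx) : fm LH G -> Prop :=
| HE_H : forall p, H_ax p -> HE_ax p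
| HE_extensionality : forall a b (f : tm G (a ~> b)) (x y : tm G a),
    HE_ax (Ext f ==> Ext x ==> Ext y ==> x =e y ==> f @ x =e f @ y).

Definition HA_prv G (p : fm LHA G) : Prop := prv (@HA_ax LHA) nil p.
Definition HE_prv G (p : fm LH G) : Prop := prv HE_ax nil p.

Fixpoint plus (a : ty) : ty :=
  match a with
  | O => O
  | s ** t => plus s ** plus t
  | s ~> t => (plus s ~> plus t) ** (plus s ~> plus s ~> minus t ~> minus s)
  end
with minus (a : ty) : ty :=
  match a with
  | O => O
  | s ** t => (minus s ** minus t) ** O
  | s ~> t => plus s ** minus t
  end.

Definition star {G a b} (s : tm G (plus (a ~> b))) (t : tm G (plus a))
  : tm G (plus b) := tfst s @ t.

(* [dom x] and [app x y z] are the formulas dom_a and app_a with terms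
   substituted for their free variables. *)
Fixpoint dom (a : ty) : forall {G}, tm G (plus a) -> fm LHA G :=
  match a with
  | O => fun G x => Top
  | s ** t => fun G x => dom (a := s) (tfst x) && dom (a := t) (tsnd x)
  | s ~> t => fun G (x : tm G (plus (s ~> t))) =>
      All (plus s)
        (dom (a := s) (Var v0) ==> dom (a := t) (star (wk x) (Var v0)))
      && All (plus s) (All (plus s) (All (minus t)
           (let x := wk (wk (wk x)) in
            let u := Var (vS (vS v0)) in
            let v := Var (vS v0) in
            let w := Var v0 in
            dom (a := s) u ==> dom (a := s) v ==>
            app (a := t) (star x u) (star x v) w ==>
            app (a := s) u v (tsnd x @ u @ v @ w))))
  end
with app (a : ty) : forall {G},
    tm G (plus a) -> tm G (plus a) -> tm G (minus a) -> fm LHA G :=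
  match a with
  | O => fun G x y z => Not (x == y)
  | s ** t => fun G x y (z : tm G (minus (s ** t))) =>
      (tsnd z == tzero ==> app (a := s) (tfst x) (tfst y) (tfst (tfst z)))
      && (Not (tsnd z == tzero) ==>
            app (a := t) (tsnd x) (tsnd y) (tsnd (tfst z)))
  | s ~> t => fun G x y (z : tm G (minus (s ~> t))) =>
      dom (a := s) (tfst z)
      && app (a := t) (star x (tfst z)) (star y (tfst z)) (tsnd z)
  end.
Arguments dom a {G} _.
Arguments app a {G} _ _ _.

(* The interpretations c^alpha of the constants, as closed terms. *)
Definition const_interp : Type := forall a, const a -> tm nil (plus a).

(* An assignment x |-> x^alpha to the variables of [G] of variables of [D]. *)
Definition asg (G D : ctx) : Type := forall a, var G a -> var D (plus a).

(* [plus] is injective, so variables of distinct types cannot be identified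
   and injectivity at each type is all that is needed. *)
Definition asg_injective {G D} (v : asg G D) : Prop :=
  forall a (x y : var G a), v a x = v a y -> x = y.

Definition up_asg {G D} b (v : asg G D) : asg (b :: G) (plus b :: D) :=
  vcase (P := fun a => var (plus b :: D) (plus a)) v0 (fun _ x => vS (v _ x)).

Fixpoint alpha_tm (ca : const_interp) {G D} (v : asg G D) a (t : tm G a)
  : tm D (plus a) :=
  match t with
  | Var x => Var (v _ x)
  | Cst c => closed (ca _ c)
  | App s t => star (alpha_tm ca v s) (alpha_tm ca v t)
  end.

Fixpoint alpha_fm (ca : const_interp) {G D} (v : asg G D) (p : fm LH G)
  : fm LHA D :=
  match p with
  | Bot => Bot
  | Eqv s t => alpha_tm ca v s == alpha_tm ca v t
  | @ExtAt _ _ _ a t => dom a (alpha_tm ca v t)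
  | @HeqAt _ _ _ a s t =>
      Not (Ex (minus a)
             (app a (wk (alpha_tm ca v s)) (wk (alpha_tm ca v t)) (Var v0)))
  | And p q => And (alpha_fm ca v p) (alpha_fm ca v q)
  | Or p q => Or (alpha_fm ca v p) (alpha_fm ca v q)
  | Imp p q => Imp (alpha_fm ca v p) (alpha_fm ca v q)
  | All a p => All (plus a) (alpha_fm ca (up_asg v) p)
  | Ex a p => Ex (plus a) (alpha_fm ca (up_asg v) p)
  end.

(* Main.v *)
(* An element of type [plus (a ~> b)] is a function together with a modulus, which
   turns an observation separating [x u] from [x v] into one separating [u] from
   [v]; hence every element satisfying [dom] is extensional, and the point is to
   equip each constant with a modulus.  For [s], and for the recursor in its step
   argument, the modulus must decide which of two changes is responsible for a
   difference.  This is possible because an observation [z] has a numerical value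
   [ev a x z] and [app a x y z] amounts to [ev a x z <> ev a y z], provided that
   [z] is well-formed, a condition in which neither [x] nor [y] occurs; so it
   suffices to compare two numbers.  The moduli of the recursor are themselves
   defined by recursion.  Derivations in HA^omega are built semantically: to
   derive an implication or a universal formula one passes to an arbitrary later
   world, a context with hypotheses reached by a substitution. *)
From Stdlib Require Import List.
From Stdlib Require Import -(notations) Setoid Morphisms.
Require Import Defs.

Set Implicit Arguments.
Unset Strict Implicit.
Unset Printing Implicit Defensive.
Local Open Scope ty_scope.
Local Open Scope tm_scope.
Local Open Scope fm_scope.

#[local] Arguments wk : simpl never.
#[local] Arguments wkf : simpl never.

(** * Substitution *)

(** The return clause computes on the context and quantifies over [P] inside it, so inverting
    [var (b :: G) a] requires no axiom about equality of contexts. Statements about substitutions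
    out of an extended context are checked on [v0] and on [vS] in this way. *)
Lemma var_case b G (P : forall a, var (b :: G) a -> Prop) :
  P b v0 -> (forall a (y : var G a), P a (vS y)) -> forall a x, P a x.
Proof.
  intros h0 hS a x.
  revert P h0 hS.
  refine (match x as x' in var G' a' return
    match G' return var G' a' -> Prop with
    | nil => fun _ => True
    | b' :: G'' => fun x' => forall P : forall a, var (b' :: G'') a -> Prop,
        P b' v0 -> (forall a (y : var G'' a), P a (vS y)) -> P a' x'
    end x' with v0 => _ | vS y => _ end); auto.
Qed.

Definition scons G D b (t : tm D b) (s : sub G D) : sub (b :: G) D :=
  vcase (P := tm D) t s.
Definition comp G D E (s : sub G D) (s' : sub D E) : sub G E :=
  fun a x => sub_tm s' (s a x).
(** Renamings are absorbed into substitutions, so that weakening obeys the composition laws of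
    substitutions. *)
Definition of_ren G D (r : ren G D) : sub G D := fun a x => Var (r a x).
Arguments scons {G D b} t s a x.
Arguments comp {G D E} s s' a x.
Arguments of_ren {G D} r a x.
(** Pointwise agreement replaces equality of functions, since function extensionality is not
    assumed. *)
Definition seq G D (s s' : sub G D) : Prop := forall a x, s a x = s' a x.

Lemma seq_up G D b (s s' : sub G D) : seq s s' -> seq (up_sub (b := b) s) (up_sub s').
Proof.
  intros h. unfold seq. apply var_case; [reflexivity|].
  intros a y; cbn. now rewrite h.
Qed.

Lemma sub_tm_seq G D (s s' : sub G D) a (t : tm G a) :
  seq s s' -> sub_tm s t = sub_tm s' t.
Proof. intros h; induction t; cbn; auto; congruence. Qed.

Lemma sub_fm_seq L G (p : fm L G) : forall D (s s' : sub G D),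
  seq s s' -> sub_fm s p = sub_fm s' p.
Proof.
  induction p; intros D s s' E; cbn; f_equal; auto using sub_tm_seq, seq_up.
Qed.

Lemma ren_tm_of_ren G D (r : ren G D) a (t : tm G a) : ren_tm r t = sub_tm (of_ren r) t.
Proof. induction t; cbn; auto; congruence. Qed.

Lemma up_of_ren G D b (r : ren G D) :
  seq (of_ren (up_ren (b := b) r)) (up_sub (of_ren r)).
Proof. unfold seq. apply var_case; reflexivity. Qed.

Lemma ren_fm_of_ren L G (p : fm L G) : forall D (r : ren G D),
  ren_fm r p = sub_fm (of_ren r) p.
Proof.
  induction p; intros D r; cbn; rewrite ?ren_tm_of_ren; f_equal; auto;
    rewrite IHp; apply sub_fm_seq, up_of_ren.
Qed.

Lemma wkE G b a (t : tm G a) : wk (b := b) t = sub_tm (of_ren (shift b)) t.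
Proof. apply ren_tm_of_ren. Qed.

Lemma wkfE L G b (p : fm L G) : wkf (b := b) p = sub_fm (of_ren (shift b)) p.
Proof. apply ren_fm_of_ren. Qed.

Lemma sub_of_ren G D E (r : ren G D) (s : sub D E) a (t : tm G a) :
  sub_tm s (sub_tm (of_ren r) t) = sub_tm (fun _ x => s _ (r _ x)) t.
Proof. induction t; cbn; auto; congruence. Qed.

Lemma sub_sub G D E (s : sub G D) (s' : sub D E) a (t : tm G a) :
  sub_tm s' (sub_tm s t) = sub_tm (comp s s') t.
Proof. induction t; cbn; auto; congruence. Qed.

Lemma up_comp G D E b (s : sub G D) (s' : sub D E) :
  seq (comp (up_sub (b := b) s) (up_sub s')) (up_sub (comp s s')).
Proof.
  unfold seq. apply var_case; [reflexivity|]. intros a y; unfold comp; cbn.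
  rewrite !wkE, sub_of_ren, sub_sub. apply sub_tm_seq. intros c z.
  unfold comp; cbn. apply wkE.
Qed.

Lemma sub_sub_fm L G (p : fm L G) : forall D E (s : sub G D) (s' : sub D E),
  sub_fm s' (sub_fm s p) = sub_fm (comp s s') p.
Proof.
  induction p; intros D E s s'; cbn; rewrite ?sub_sub; f_equal; auto;
    rewrite IHp; apply sub_fm_seq, up_comp.
Qed.

Lemma sub_tm_id G (s : sub G G) a (t : tm G a) :
  seq s (fun _ x => Var x) -> sub_tm s t = t.
Proof. intros h; induction t; cbn; auto; congruence. Qed.

Lemma up_id G b (s : sub G G) :
  seq s (fun _ x => Var x) -> seq (up_sub (b := b) s) (fun _ x => Var x).
Proof.
  intros h. unfold seq. apply var_case; [reflexivity|]. intros; cbn. now rewrite h.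
Qed.

Lemma sub_fm_id L G (p : fm L G) : forall s : sub G G,
  seq s (fun _ x => Var x) -> sub_fm s p = p.
Proof.
  induction p; intros s' E; cbn; rewrite ?sub_tm_id by assumption;
    f_equal; auto using up_id.
Qed.

Lemma sub_wk G D b (t : tm D b) (s : sub G D) a (u : tm G a) :
  sub_tm (scons t s) (wk u) = sub_tm s u.
Proof. rewrite wkE, sub_of_ren. now apply sub_tm_seq. Qed.

Lemma up_wk G D b (s : sub G D) a (u : tm G a) :
  sub_tm (up_sub (b := b) s) (wk u) = wk (sub_tm s u).
Proof.
  rewrite !wkE, sub_of_ren, sub_sub. apply sub_tm_seq. intros c x; cbn. apply wkE.
Qed.

Lemma up_wkf L G D b (s : sub G D) (p : fm L G) :
  sub_fm (up_sub (b := b) s) (wkf p) = wkf (sub_fm s p).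
Proof.
  rewrite !wkfE, !sub_sub_fm. apply sub_fm_seq. intros c x; cbn. apply wkE.
Qed.

Lemma instE L G b (p : fm L (b :: G)) t : inst p t = sub_fm (scons t (fun _ x => Var x)) p.
Proof. reflexivity. Qed.

Lemma inst_wk G b (t : tm G b) a (u : tm G a) :
  sub_tm (scons t (fun _ x => Var x)) (wk u) = u.
Proof. rewrite sub_wk. now apply sub_tm_id. Qed.

(** Instantiating a substituted body is a single simultaneous substitution; the quantifier rules for
    worlds below are therefore phrased with [scons]. *)
Lemma inst_up L G D b (s : sub G D) (p : fm L (b :: G)) t :
  inst (sub_fm (up_sub s) p) t = sub_fm (scons t s) p.
Proof.
  rewrite instE, sub_sub_fm. apply sub_fm_seq. unfold seq. apply var_case.
  - reflexivity.
  - intros a y; unfold comp; cbn. apply inst_wk.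
Qed.

Lemma sub_inst L G D b (s : sub G D) (p : fm L (b :: G)) t :
  sub_fm s (inst p t) = inst (sub_fm (up_sub s) p) (sub_tm s t).
Proof.
  rewrite inst_up, instE, sub_sub_fm. apply sub_fm_seq. unfold seq. now apply var_case.
Qed.

Lemma sub_succ_inst L G D (s : sub G D) (p : fm L (O :: G)) :
  sub_fm (up_sub s) (succ_inst p) = succ_inst (sub_fm (up_sub s) p).
Proof.
  unfold succ_inst. rewrite !sub_sub_fm. apply sub_fm_seq. unfold seq. apply var_case.
  - reflexivity.
  - intros a y; unfold comp; cbn. rewrite !wkE, sub_of_ren. apply sub_tm_seq. now intros c x.
Qed.

Lemma sub_HA_ax L G D (s : sub G D) (p : fm L G) : HA_ax p -> HA_ax (sub_fm s p).
Proof.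
  destruct 1; cbn; try constructor.
  rewrite sub_inst, sub_succ_inst. cbn. apply ax_ind.
Qed.

(** * Derivations and worlds *)

Lemma prv_mono L Ax G (H H' : list (fm L G)) p :
  incl H H' -> prv Ax H p -> prv Ax H' p.
Proof.
  intros h d; revert H' h. induction d; intros H' h.
  - now apply prv_ax.
  - apply prv_hyp; auto.
  - apply prv_botE; auto.
  - apply prv_andI; auto.
  - eapply prv_andE1; eauto.
  - eapply prv_andE2; eauto.
  - apply prv_orI1; auto.
  - apply prv_orI2; auto.
  - eapply prv_orE; [apply IHd1, h | apply IHd2 | apply IHd3];
      apply incl_cons; auto using in_eq, incl_tl.
  - apply prv_impI, IHd. apply incl_cons; auto using in_eq, incl_tl.
  - eapply prv_impE; eauto.
  - apply prv_allI, IHd. now apply incl_map.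
  - apply prv_allE; auto.
  - eapply prv_exI; eauto.
  - eapply prv_exE; eauto. apply IHd2. apply incl_cons; auto using in_eq, incl_tl, incl_map.
Qed.

Notation "H ⊢ p" := (prv (@HA_ax LHA) H p) (at level 99, no associativity).

Lemma prv_weaken G (H : list (fm LHA G)) p q : H ⊢ p -> q :: H ⊢ p.
Proof. apply prv_mono. auto using incl_tl, incl_refl. Qed.

Lemma map_wkf_sub L G D b (s : sub G D) (H : list (fm L G)) :
  map (sub_fm (up_sub (b := b) s)) (map wkf H) = map wkf (map (sub_fm s) H).
Proof. rewrite !map_map. apply map_ext. intros q. apply up_wkf. Qed.

(** The axioms are closed under substitution, being given by all their instances. This makes
    derivability persist along the change of context in a world. *)
Lemma prv_sub G (H : list (fm LHA G)) p : H ⊢ p ->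
  forall D (s : sub G D), map (sub_fm s) H ⊢ sub_fm s p.
Proof.
  induction 1; intros D s'; cbn in *.
  - now apply prv_ax, sub_HA_ax.
  - now apply prv_hyp, in_map.
  - now apply prv_botE.
  - now apply prv_andI.
  - eapply prv_andE1; eauto.
  - eapply prv_andE2; eauto.
  - now apply prv_orI1.
  - now apply prv_orI2.
  - eapply prv_orE; eauto.
  - now apply prv_impI.
  - eapply prv_impE; eauto.
  - apply prv_allI. rewrite <- map_wkf_sub. auto.
  - rewrite sub_inst. now apply prv_allE.
  - apply prv_exI with (t := sub_tm s' t). rewrite <- sub_inst. auto.
  - eapply prv_exE; eauto. rewrite <- map_wkf_sub, <- up_wkf. auto.
Qed.

(* A world is a context together with a list of hypotheses. *)
Definition wld G D (s : sub G D) (H : list (fm LHA G)) (H' : list (fm LHA D)) : Prop :=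
  forall p, H ⊢ p -> H' ⊢ sub_fm s p.
(** A change of hypotheses over a fixed context, kept apart from [wld] so that no identity
    substitution appears in formulas. *)
Definition later G (H H' : list (fm LHA G)) : Prop := forall p, H ⊢ p -> H' ⊢ p.

Lemma wld_wk G b (H : list (fm LHA G)) : wld (of_ren (shift b)) H (map wkf H).
Proof.
  intros p d. erewrite map_ext; [now apply prv_sub|]. intros q; apply wkfE.
Qed.

Lemma later_cons G (H : list (fm LHA G)) p : later H (p :: H).
Proof. intros q; apply prv_weaken. Qed.

Lemma later_trans G (H H1 H2 : list (fm LHA G)) : later H H1 -> later H1 H2 -> later H H2.
Proof. unfold later; auto. Qed.

Lemma wld_later G D (s : sub G D) H H1 H2 : wld s H H1 -> later H1 H2 -> wld s H H2.
Proof. unfold later, wld; auto. Qed.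

(** The Kripke clause for implication. The generic later world is [H] with [p] added; quantifying
    over all later worlds hides the list of hypotheses from the proofs below. *)
Lemma impI G (H : list (fm LHA G)) p q :
  (forall H', later H H' -> H' ⊢ p -> H' ⊢ q) -> H ⊢ p ==> q.
Proof. intros h. apply prv_impI, h; [apply later_cons | apply prv_hyp, in_eq]. Qed.

Lemma orE G (H : list (fm LHA G)) p q r : H ⊢ Or p q ->
  (forall H', later H H' -> H' ⊢ p -> H' ⊢ r) ->
  (forall H', later H H' -> H' ⊢ q -> H' ⊢ r) -> H ⊢ r.
Proof.
  intros d hp hq. apply (prv_orE d); [apply hp | apply hq];
    auto using later_cons, prv_hyp, in_eq.
Qed.

Lemma shift_id L G b (p : fm L (b :: G)) :
  sub_fm (scons (Var v0) (of_ren (shift b))) p = p.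
Proof. apply sub_fm_id. unfold seq. now apply var_case. Qed.

(** The Kripke clause for the universal quantifier: the generic world is the weakening of [H], and
    the generic element is the fresh variable. *)
Lemma allI G (H : list (fm LHA G)) b (p : fm LHA (b :: G)) :
  (forall D (s : sub G D) H', wld s H H' -> forall t, H' ⊢ sub_fm (scons t s) p) ->
  H ⊢ All b p.
Proof.
  intros h. apply prv_allI. rewrite <- (shift_id p). apply h, wld_wk.
Qed.

Lemma allE G (H : list (fm LHA G)) b (p : fm LHA (b :: G)) t :
  H ⊢ All b p -> H ⊢ sub_fm (scons t (fun _ x => Var x)) p.
Proof. exact (prv_allE t). Qed.

Lemma allE_wld G D (s : sub G D) H H' b (p : fm LHA (b :: G)) t :
  wld s H H' -> H ⊢ All b p -> H' ⊢ sub_fm (scons t s) p.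
Proof. intros w d. apply w in d. rewrite <- inst_up. now apply prv_allE. Qed.

Lemma exI G (H : list (fm LHA G)) b (p : fm LHA (b :: G)) t :
  H ⊢ sub_fm (scons t (fun _ x => Var x)) p -> H ⊢ Ex b p.
Proof. exact (prv_exI (t := t)). Qed.

Lemma exE G (H : list (fm LHA G)) b (p : fm LHA (b :: G)) q : H ⊢ Ex b p ->
  (forall D (s : sub G D) H', wld s H H' -> forall t, H' ⊢ sub_fm (scons t s) p ->
    H' ⊢ sub_fm s q) -> H ⊢ q.
Proof.
  intros d h. apply (prv_exE d). rewrite wkfE. eapply h.
  - eapply wld_later; [apply wld_wk | apply later_cons].
  - rewrite shift_id. apply prv_hyp, in_eq.
Qed.

Lemma ind G (H : list (fm LHA G)) (p : fm LHA (O :: G)) :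
  H ⊢ sub_fm (scons tzero (fun _ x => Var x)) p ->
  (forall D (s : sub G D) H', wld s H H' -> forall m, H' ⊢ sub_fm (scons m s) p ->
    H' ⊢ sub_fm (scons (tsucc m) s) p) ->
  forall t, H ⊢ sub_fm (scons t (fun _ x => Var x)) p.
Proof.
  intros h0 hS t. apply allE.
  eapply prv_impE; [eapply prv_impE; [apply prv_ax, ax_ind | exact h0] |].
  apply allI. intros D s H' w m. cbn. apply impI. intros H'' l d.
  unfold succ_inst. rewrite sub_sub_fm.
  erewrite sub_fm_seq; [apply (hS _ _ _ (wld_later w l)), d|].
  unfold seq. now apply var_case.
Qed.

Lemma notI G (H : list (fm LHA G)) p :
  (forall H', later H H' -> H' ⊢ p -> H' ⊢ Bot) -> H ⊢ Not p.
Proof. apply impI. Qed.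

Lemma notE G (H : list (fm LHA G)) p q : H ⊢ Not p -> H ⊢ p -> H ⊢ q.
Proof. intros d e. apply prv_botE. exact (prv_impE d e). Qed.

(** * Rewriting with provable equality *)

(** Provable equality under fixed hypotheses is named as a relation on terms to make setoid
    rewriting available; [feq] does the same for formulas. *)
Definition eqv G (H : list (fm LHA G)) a (t u : tm G a) : Prop := H ⊢ t == u.
Arguments eqv {G} H {a} t u.
Definition feq G (H : list (fm LHA G)) (p q : fm LHA G) : Prop := H ⊢ Iff p q.

#[local] Instance eqv_equiv G H a : Equivalence (@eqv G H a).
Proof.
  split.
  - intros x. apply prv_ax, ax_refl.
  - intros x y d. exact (prv_impE (prv_ax _ (ax_sym _ x y)) d).
  - intros x y z d e. exact (prv_impE (prv_impE (prv_ax _ (ax_trans _ x y z)) d) e).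
Qed.

#[local] Instance App_proper G H a b :
  Proper (respectful (eqv H) (respectful (eqv H) (eqv H))) (@App G a b).
Proof.
  intros x x' d y y' e. exact (prv_impE (prv_impE (prv_ax _ (ax_app _ x x' y y')) d) e).
Qed.

Lemma eqv_later G (H H' : list (fm LHA G)) a (t u : tm G a) :
  later H H' -> eqv H t u -> eqv H' t u.
Proof. intros l; apply l. Qed.

Lemma eqv_wld G D (s : sub G D) H H' a (t u : tm G a) :
  wld s H H' -> eqv H t u -> eqv H' (sub_tm s t) (sub_tm s u).
Proof. intros w d. exact (w _ d). Qed.

(** The Leibniz principle for arbitrary formulas, by induction on the formula. The implication case
    uses the induction hypothesis with the two substitutions exchanged, hence the assertion [sym];
    the quantifier cases move to a world [f], hence the comparison of [scons t (comp s f)] with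
    [scons t (comp s' f)]. *)
Lemma sub_eqv_aux G (p : fm LHA G) : forall D (s s' : sub G D) H,
  (forall a x, eqv H (s a x) (s' a x)) -> H ⊢ sub_fm s p -> H ⊢ sub_fm s' p.
Proof.
  assert (tmE : forall G D (s s' : sub G D) H, (forall a x, eqv H (s a x) (s' a x)) ->
    forall a (t : tm G a), eqv H (sub_tm s t) (sub_tm s' t)).
  { intros G0 D s s' H h a t. induction t; cbn; auto; [reflexivity|].
    now rewrite IHt1, IHt2. }
  assert (sym : forall G D (s s' : sub G D) H, (forall a x, eqv H (s a x) (s' a x)) ->
    forall a x, eqv H (s' a x) (s a x)) by (intros; symmetry; auto).
  assert (up : forall G D E b (s s' : sub G D) (f : sub D E) H H' (t : tm E b), wld f H H' ->
    (forall a x, eqv H (s a x) (s' a x)) ->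
    forall a x, eqv H' (scons t (comp s f) a x) (scons t (comp s' f) a x)).
  { intros G0 D E b s s' f H H' t w h. apply var_case; [reflexivity|].
    intros a y. unfold comp; cbn. apply (eqv_wld w), h. }
  assert (upE : forall G D E b (p : fm LHA (b :: G)) (s : sub G D) (f : sub D E) t,
    sub_fm (scons t f) (sub_fm (up_sub s) p) = sub_fm (scons t (comp s f)) p).
  { intros. rewrite sub_sub_fm. apply sub_fm_seq. unfold seq. apply var_case; [reflexivity|].
    intros; unfold comp; cbn. apply sub_wk. }
  (* [contradiction] disposes of Ext and of hereditary equality, which do not occur in the language
     [LHA]. *)
  induction p; intros D s s' H hs d; cbn in *; try contradiction.
  - exact d.
  - change (eqv H (sub_tm s' t) (sub_tm s' t0)).
    rewrite <- (tmE _ _ s s' H hs _ t), <- (tmE _ _ s s' H hs _ t0). exact d.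
  - apply prv_andI; [eapply IHp1 | eapply IHp2]; eauto using prv_andE1, prv_andE2.
  - apply (orE d); intros H' l e; [apply prv_orI1; eapply IHp1 | apply prv_orI2; eapply IHp2];
      eauto using eqv_later.
  - apply impI. intros H' l e. eapply IHp2; [eauto using eqv_later|].
    eapply prv_impE; [apply l, d|]. eapply IHp1; [|exact e]. eauto using eqv_later.
  - apply allI. intros E f H' w t. rewrite upE. eapply IHp; [eauto|].
    rewrite <- upE. apply (allE_wld t w d).
  - apply (exE d). intros E f H' w t e. cbn. apply prv_exI with (t := t).
    rewrite inst_up, upE. rewrite upE in e.
    eapply IHp; [apply (up _ _ _ _ _ _ _ _ _ t w hs) | exact e].
Qed.

Lemma wld_comp G D E (s : sub G D) (f : sub D E) H1 H2 H3 :
  wld s H1 H2 -> wld f H2 H3 -> wld (comp s f) H1 H3.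
Proof. intros w1 w2 p d. rewrite <- sub_sub_fm. apply w2, w1, d. Qed.

(** The modulus clause of [dom] at arrow types has three quantifiers in a row. Introducing them
    together passes to one world only, instead of a chain of three. *)
Lemma all3I G (H : list (fm LHA G)) a b c (p : fm LHA (c :: b :: a :: G)) :
  (forall D (s : sub G D) H', wld s H H' -> forall u v w,
    H' ⊢ sub_fm (scons w (scons v (scons u s))) p) ->
  H ⊢ All a (All b (All c p)).
Proof.
  intros h. do 3 apply prv_allI.
  (* The identity on the extended context is written as three values on top of a weakening. *)
  rewrite <- (sub_fm_id p (s := scons (Var v0) (scons (Var (vS v0)) (scons (Var (vS (vS v0)))
    (comp (comp (of_ren (shift a)) (of_ren (shift b))) (of_ren (shift c))))))).
  - apply h. eauto using wld_comp, wld_wk.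
  - unfold seq. repeat (apply var_case; [reflexivity|]). reflexivity.
Qed.

Lemma all3E G (H : list (fm LHA G)) a b c (p : fm LHA (c :: b :: a :: G)) u v w :
  H ⊢ All a (All b (All c p)) ->
  H ⊢ sub_fm (scons w (scons v (scons u (fun _ x => Var x)))) p.
Proof.
  intros d. apply (allE u) in d.
  assert (e : forall G D (s : sub G D) a (p : fm LHA (a :: G)) H t,
    H ⊢ sub_fm s (All a p) -> H ⊢ sub_fm (scons t s) p).
  { intros G' D s a' q H' t e. rewrite <- inst_up. exact (prv_allE t e). }
  apply e, e, d.
Qed.

Lemma sub_eqv G D (p : fm LHA G) (s s' : sub G D) H :
  (forall a x, eqv H (s a x) (s' a x)) -> feq H (sub_fm s p) (sub_fm s' p).
Proof.
  intros h. apply prv_andI; apply impI; intros H' l; apply sub_eqv_aux;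
    intros a x; [|symmetry]; now apply (eqv_later l).
Qed.

#[local] Instance feq_equiv G H : Equivalence (@feq G H).
Proof.
  split; unfold feq, Iff.
  - intros p. apply prv_andI; apply impI; auto.
  - intros p q d. apply prv_andI; eauto using prv_andE1, prv_andE2.
  - intros p q r d e. apply prv_andI; apply impI; intros H' l f.
    + eapply prv_impE; [apply l; eapply prv_andE1, e|].
      eapply prv_impE; [apply l; eapply prv_andE1, d|]. exact f.
    + eapply prv_impE; [apply l; eapply prv_andE2, d|].
      eapply prv_impE; [apply l; eapply prv_andE2, e|]. exact f.
Qed.

#[local] Instance prv_proper G H : Proper (respectful (feq H) iff) (@prv LHA (@HA_ax LHA) G H).
Proof.
  intros p q d. split; intros e; [eapply prv_impE; [eapply prv_andE1, d|]|
    eapply prv_impE; [eapply prv_andE2, d|]]; exact e.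
Qed.

#[local] Instance Imp_proper G H :
  Proper (respectful (feq H) (respectful (feq H) (feq H))) (@Imp LHA G).
Proof.
  intros p p' d q q' e. apply prv_andI; apply impI; intros H' l f;
    apply impI; intros H2 l2 g; (eapply prv_impE; [apply l2, l|]).
  - eapply prv_andE1, e.
  - eapply prv_impE; [apply l2, f|]. eapply prv_impE; [|exact g].
    apply l2, l. eapply prv_andE2, d.
  - eapply prv_andE2, e.
  - eapply prv_impE; [apply l2, f|]. eapply prv_impE; [|exact g].
    apply l2, l. eapply prv_andE1, d.
Qed.

#[local] Instance Not_proper G H : Proper (respectful (feq H) (feq H)) (@Not LHA G).
Proof. intros p q d. unfold Not. now rewrite d. Qed.

#[local] Instance Eqv_proper G H a :
  Proper (respectful (eqv H) (respectful (eqv H) (feq H))) (@Eqv LHA G a).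
Proof.
  intros x x' d y y' e. apply prv_andI; apply impI; intros H' l f;
    apply (eqv_later l) in d, e; fold (eqv H' x y) in *; fold (eqv H' x' y') in *.
  - change (eqv H' x' y'). rewrite <- d, <- e. exact f.
  - change (eqv H' x y). rewrite d, e. exact f.
Qed.

(** * Substitution and rewriting inside [dom] and [app] *)

Lemma sub_dom_app a :
  (forall G D (s : sub G D) x, sub_fm s (dom a x) = dom a (sub_tm s x)) /\
  (forall G D (s : sub G D) x y z,
     sub_fm s (app a x y z) = app a (sub_tm s x) (sub_tm s y) (sub_tm s z)).
Proof.
  induction a as [|a [IHa1 IHa2] b [IHb1 IHb2]|a [IHa1 IHa2] b [IHb1 IHb2]];
    (split; [intros G D s x | intros G D s x y z]); cbn;
    rewrite ?IHa1, ?IHa2, ?IHb1, ?IHb2; cbn; unfold star, tfst, tsnd; cbn;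
    rewrite ?up_wk; reflexivity.
Qed.

Lemma sub_dom a G D (s : sub G D) x : sub_fm s (dom a x) = dom a (sub_tm s x).
Proof. apply sub_dom_app. Qed.
Lemma sub_app a G D (s : sub G D) x y z :
  sub_fm s (app a x y z) = app a (sub_tm s x) (sub_tm s y) (sub_tm s z).
Proof. apply sub_dom_app. Qed.

#[local] Instance dom_proper a G H : Proper (respectful (eqv H) (feq H)) (@dom a G).
Proof.
  intros x y d.
  (* The argument of [dom] is abstracted to a variable, so that the Leibniz principle applies with
     two substitutions for it. *)
  assert (e := @sub_eqv _ _ (dom a (Var v0)) (scons x (fun _ z => Var z))
    (scons y (fun _ z => Var z)) H).
  rewrite !sub_dom in e. apply e. apply var_case; [exact d|]. reflexivity.
Qed.

#[local] Instance app_proper a G H :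
  Proper (respectful (eqv H) (respectful (eqv H) (respectful (eqv H) (feq H)))) (@app a G).
Proof.
  intros x x' d y y' e z z' f.
  assert (g := @sub_eqv _ _ (app a (Var v0) (Var (vS v0)) (Var (vS (vS v0))))
    (scons x (scons y (scons z (fun _ z => Var z))))
    (scons x' (scons y' (scons z' (fun _ z => Var z)))) H).
  rewrite !sub_app in g. apply g. repeat (apply var_case; [assumption|]). reflexivity.
Qed.

#[local] Arguments dom : simpl never.
#[local] Arguments app : simpl never.

#[local] Instance tfst_proper G H a b : Proper (respectful (eqv H) (eqv H)) (@tfst G a b).
Proof. intros x y d. unfold tfst. now rewrite d. Qed.
#[local] Instance tsnd_proper G H a b : Proper (respectful (eqv H) (eqv H)) (@tsnd G a b).
Proof. intros x y d. unfold tsnd. now rewrite d. Qed.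
#[local] Instance tsucc_proper G H : Proper (respectful (eqv H) (eqv H)) (@tsucc G).
Proof. intros x y d. unfold tsucc. now rewrite d. Qed.
#[local] Instance star_proper G H a b :
  Proper (respectful (eqv H) (respectful (eqv H) (eqv H))) (@star G a b).
Proof. intros x y d x' y' d'. unfold star. now rewrite d, d'. Qed.

Lemma fst_pair G H a b (x : tm G a) (y : tm G b) : eqv H (tfst (tpair x y)) x.
Proof. apply prv_ax, ax_fst. Qed.
Lemma snd_pair G H a b (x : tm G a) (y : tm G b) : eqv H (tsnd (tpair x y)) y.
Proof. apply prv_ax, ax_snd. Qed.
Lemma k_eq G H a b (x : tm G a) (y : tm G b) : eqv H (tk a b @ x @ y) x.
Proof. apply prv_ax, ax_k. Qed.
Lemma s_eq G H a b c (x : tm G (a ~> b ~> c)) y z :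
  eqv H (ts a b c @ x @ y @ z) (x @ z @ (y @ z)).
Proof. apply prv_ax, ax_s. Qed.
Lemma rec0_eq G H a (x : tm G a) y : eqv H (trec a @ x @ y @ tzero) x.
Proof. apply prv_ax, ax_rec0. Qed.
Lemma recS_eq G H a (x : tm G a) y m :
  eqv H (trec a @ x @ y @ tsucc m) (y @ m @ (trec a @ x @ y @ m)).
Proof. apply prv_ax, ax_recS. Qed.

(** * Abstraction *)

Notation "#0" := (Var v0).
Notation "#1" := (Var (vS v0)).
Notation "#2" := (Var (vS (vS v0))).
Notation "#3" := (Var (vS (vS (vS v0)))).
Notation "#4" := (Var (vS (vS (vS (vS v0))))).
Notation "#5" := (Var (vS (vS (vS (vS (vS v0)))))).

(** Bracket abstraction, the bound variable becoming the identity combinator built from [ts] and two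
    copies of [tk]. *)
Fixpoint lam G a b (t : tm (a :: G) b) : tm G (a ~> b) :=
  match t in tm _ b return tm G (a ~> b) with
  | Var x => vcase (P := fun b => tm G (a ~> b))
      (ts a (a ~> a) a @ tk a (a ~> a) @ tk a a) (fun _ y => tk _ _ @ Var y) x
  | Cst c => tk _ _ @ Cst c
  | App u v => ts _ _ _ @ lam u @ lam v
  end.

(* Substitution does not commute with [lam] (not even up to provable equality);
   [sub_tm s (lam t)] acts as a closure with environment [s]. *)
Lemma beta G D H (s : sub G D) a b (t : tm (a :: G) b) u :
  eqv H (sub_tm s (lam t) @ u) (sub_tm (scons u s) t).
Proof.
  induction t as [b x|b c|b c t1 IH1 t2 IH2].
  - revert b x. apply var_case.
    + cbn. change (eqv H (ts a (a ~> a) a @ tk a (a ~> a) @ tk a a @ u) u).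
      now rewrite s_eq, k_eq.
    + intros b y. apply k_eq.
  - apply k_eq.
  - cbn. etransitivity; [apply s_eq|]. now rewrite IH1, IH2.
Qed.

(** Recursion at the function type [w ~> a], so that the parameter may change from one stage to the
    next. In [c], the variable of index 0 is the parameter, index 1 is the function obtained at the
    predecessor, and index 2 is the predecessor. *)
Definition prim G w a (b : tm (w :: G) a) (c : tm (w :: (w ~> a) :: O :: G) a)
  : tm G (O ~> w ~> a) := trec _ @ lam b @ lam (lam (lam c)).

Lemma prim0 G D H (s : sub G D) w a (b : tm (w :: G) a) c u :
  eqv H (sub_tm s (prim b c) @ tzero @ u) (sub_tm (scons u s) b).
Proof.
  rewrite <- beta. apply App_proper; [|reflexivity]. apply rec0_eq.
Qed.

Lemma primS G D H (s : sub G D) w a (b : tm (w :: G) a) c m u :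
  eqv H (sub_tm s (prim b c) @ tsucc m @ u)
    (sub_tm (scons u (scons (sub_tm s (prim b c) @ m) (scons m s))) c).
Proof.
  rewrite <- beta. apply App_proper; [|reflexivity].
  rewrite <- beta. etransitivity; [apply recS_eq|].
  apply App_proper; [|reflexivity]. apply beta.
Qed.

(** The empty environment: a closed term becomes a closure over it, which brings [beta] and the
    rules of [prim] to bear on [closed]. *)
Definition snil G : sub nil G := fun a x => Var (ren_nil x).
Arguments snil {G} a x.

Lemma closedE G a (t : tm nil a) : closed t = sub_tm (@snil G) t.
Proof. apply ren_tm_of_ren. Qed.

Lemma var_nil a (x : var nil a) : False.
Proof.
  refine (match x in var G _ return match G with nil => False | _ => True end with
          | v0 => I | vS _ => I end).
Qed.

Lemma sub_closed G D (s : sub G D) a (t : tm nil a) : sub_tm s (closed t) = closed t.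
Proof. rewrite !closedE, sub_sub. apply sub_tm_seq. intros b x. destruct (var_nil x). Qed.

Lemma beta0 G (H : list (fm LHA G)) a b (t : tm (a :: nil) b) u :
  eqv H (closed (lam t) @ u) (sub_tm (scons u snil) t).
Proof. rewrite closedE. apply beta. Qed.

Lemma prim00 G (H : list (fm LHA G)) w a (b : tm (w :: nil) a) c u :
  eqv H (closed (prim b c) @ tzero @ u) (sub_tm (scons u snil) b).
Proof. rewrite closedE. apply prim0. Qed.

Lemma prim0S G (H : list (fm LHA G)) w a (b : tm (w :: nil) a) c m u :
  eqv H (closed (prim b c) @ tsucc m @ u)
    (sub_tm (scons u (scons (closed (prim b c) @ m) (scons m snil))) c).
Proof. rewrite closedE. apply primS. Qed.

#[global] Opaque lam prim closed.

Lemma sub_tfst G D (s : sub G D) a b (x : tm G (a ** b)) : sub_tm s (tfst x) = tfst (sub_tm s x).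
Proof. reflexivity. Qed.
Lemma sub_tsnd G D (s : sub G D) a b (x : tm G (a ** b)) : sub_tm s (tsnd x) = tsnd (sub_tm s x).
Proof. reflexivity. Qed.
Lemma sub_tpair G D (s : sub G D) a b (x : tm G a) (y : tm G b) :
  sub_tm s (tpair x y) = tpair (sub_tm s x) (sub_tm s y).
Proof. reflexivity. Qed.
Lemma sub_tsucc G D (s : sub G D) x : sub_tm s (tsucc x) = tsucc (sub_tm s x).
Proof. reflexivity. Qed.
Lemma sub_tzero G D (s : sub G D) : sub_tm s tzero = tzero.
Proof. reflexivity. Qed.
Lemma sub_star G D (s : sub G D) a b (x : tm G (plus (a ~> b))) y :
  sub_tm s (star x y) = star (sub_tm s x) (sub_tm s y).
Proof. reflexivity. Qed.
Lemma sub_App G D (s : sub G D) a b (x : tm G (a ~> b)) y :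
  sub_tm s (x @ y) = sub_tm s x @ sub_tm s y.
Proof. reflexivity. Qed.
Lemma sub_v0 G D (s : sub G D) a (t : tm D a) : sub_tm (scons t s) #0 = t.
Proof. reflexivity. Qed.
Lemma sub_vS G D (s : sub G D) b (t : tm D b) a (x : var G a) :
  sub_tm (scons t s) (Var (vS x)) = sub_tm s (Var x).
Proof. reflexivity. Qed.
Lemma sub_comp_v G D E (s : sub G D) (f : sub D E) a (x : var G a) :
  sub_tm (comp s f) (Var x) = sub_tm f (sub_tm s (Var x)).
Proof. reflexivity. Qed.
Lemma sub_Not L G D (s : sub G D) (p : fm L G) : sub_fm s (Not p) = Not (sub_fm s p).
Proof. reflexivity. Qed.
Lemma sub_Imp L G D (s : sub G D) (p q : fm L G) : sub_fm s (p ==> q) = (sub_fm s p ==> sub_fm s q).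
Proof. reflexivity. Qed.
Lemma sub_Eqv L G D (s : sub G D) a (x y : tm G a) :
  sub_fm (L := L) s (x == y) = (sub_tm s x == sub_tm s y).
Proof. reflexivity. Qed.
#[local] Hint Rewrite sub_tfst sub_tsnd sub_tpair sub_tsucc sub_tzero sub_star sub_App
  sub_v0 sub_vS sub_comp_v sub_closed sub_dom sub_app sub_Not sub_Imp sub_Eqv sub_wk : sub.

(** Case distinction on whether [c] is zero, as a recursion whose step function constantly returns
    [q]. *)
Definition tif G a (c : tm G O) (p q : tm G a) : tm G a :=
  trec a @ p @ (tk _ O @ (tk a a @ q)) @ c.
#[local] Instance tif_proper G H a :
  Proper (respectful (eqv H) (respectful (eqv H) (respectful (eqv H) (eqv H)))) (@tif G a).
Proof. intros x x' d y y' e z z' f. unfold tif. now rewrite d, e, f. Qed.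
Lemma sub_tif G D (s : sub G D) a c (p q : tm G a) :
  sub_tm s (tif c p q) = tif (sub_tm s c) (sub_tm s p) (sub_tm s q).
Proof. reflexivity. Qed.
#[local] Hint Rewrite sub_tif : sub.

Lemma tif0 G H a c (p q : tm G a) : eqv H c tzero -> eqv H (tif c p q) p.
Proof. intros d. rewrite d. apply rec0_eq. Qed.

Lemma tifS G H a c (p q : tm G a) : eqv H (tif (tsucc c) p q) q.
Proof. unfold tif. now rewrite recS_eq, k_eq, k_eq. Qed.

Lemma tif_neq0 G H a c (p q : tm G a) : H ⊢ Not (c == tzero) -> eqv H (tif c p q) q.
Proof.
  intros d.
  assert (e := @ind _ H (Not (#0 == tzero) ==> tif #0 (wk p) (wk q) == wk q)).
  autorewrite with sub in e.
  assert (f := fun h0 hS => prv_impE (e h0 hS c)). clear e.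
  autorewrite with sub in f.
  rewrite !(sub_tm_id (s := fun _ x => Var x)) in f by (intros ? ?; reflexivity).
  apply f; [| |exact d].
  - apply impI. intros H' l g. apply (notE _ g). apply prv_ax, ax_refl.
  - intros D s H' w m _. autorewrite with sub. apply impI. intros H2 l _. apply tifS.
Qed.

Lemma zero_dec G (H : list (fm LHA G)) c : H ⊢ Or (c == tzero) (Not (c == tzero)).
Proof.
  apply (@ind _ H (Or (#0 == tzero) (Not (#0 == tzero)))).
  - apply prv_orI1, prv_ax, ax_refl.
  - intros. apply prv_orI2, prv_ax, ax_succ_neq0.
Qed.

Ltac nrm := repeat first
  [ progress autorewrite with sub
  | rewrite beta0 | rewrite beta | rewrite prim00 | rewrite prim0S | rewrite prim0 | rewrite primS
  | rewrite fst_pair | rewrite snd_pair | rewrite recS_eq | rewrite rec0_eq | rewrite tifS ].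

(** * Deciding numerical equality *)

(* The recursion equations are [deq 0 y = y], [deq (S x) 0 = 1] and
   [deq (S x) (S y) = deq x y]. *)
Definition deqC : tm nil (O ~> O ~> O) :=
  prim #0 (trec O @ tsucc tzero @ lam (lam (#3 @ #1)) @ #0).
Definition deq G (x y : tm G O) : tm G O := closed deqC @ x @ y.
#[local] Instance deq_proper G H :
  Proper (respectful (eqv H) (respectful (eqv H) (eqv H))) (@deq G).
Proof. intros x x' d y y' e. unfold deq. now rewrite d, e. Qed.
Lemma sub_deq G D (s : sub G D) x y : sub_tm s (deq x y) = deq (sub_tm s x) (sub_tm s y).
Proof. unfold deq. now autorewrite with sub. Qed.
#[local] Hint Rewrite sub_deq : sub.

Lemma deq0 G H (y : tm G O) : eqv H (deq tzero y) y.
Proof. unfold deq, deqC. nrm. reflexivity. Qed.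
Lemma deqS0 G H (x : tm G O) : eqv H (deq (tsucc x) tzero) (tsucc tzero).
Proof. unfold deq, deqC. nrm. reflexivity. Qed.
Lemma deqSS G H (x y : tm G O) : eqv H (deq (tsucc x) (tsucc y)) (deq x y).
Proof. unfold deq, deqC. nrm. reflexivity. Qed.
#[global] Opaque deq.

(** The formula [p] represents the family [P] in every world. Induction stated for [P] leaves goals
    about the actual terms, free of pending substitutions. *)
Lemma ind_sub G (H : list (fm LHA G)) (P : forall D, sub G D -> tm D O -> fm LHA D) p :
  (forall D s t, sub_fm (scons t s) p = P D s t) ->
  H ⊢ P G (fun _ x => Var x) tzero ->
  (forall D (s : sub G D) H', wld s H H' -> forall m, H' ⊢ P D s m -> H' ⊢ P D s (tsucc m)) ->
  forall t, H ⊢ P G (fun _ x => Var x) t.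
Proof.
  intros e h0 hS t. rewrite <- e in *. apply ind; [exact h0|].
  intros D s H' w m. rewrite !e. now apply hS.
Qed.

Lemma sub_id G a (t : tm G a) : sub_tm (fun _ x => Var x) t = t.
Proof. now apply sub_tm_id. Qed.
#[local] Hint Rewrite sub_id : sub.

Lemma deq_refl G H (x : tm G O) : eqv H (deq x x) tzero.
Proof.
  apply (@ind_sub _ H (fun D s t => deq t t == tzero) (deq #0 #0 == tzero)).
  - intros; now autorewrite with sub.
  - apply deq0.
  - intros D s H' _ m d. change (eqv H' (deq (tsucc m) (tsucc m)) tzero).
    rewrite deqSS. exact d.
Qed.

Lemma deq_eq G H (x y : tm G O) : eqv H (deq x y) tzero -> eqv H x y.
Proof.
  intros d. refine (prv_impE (p := deq x y == tzero) _ d). clear d.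
  (* The second number is quantified inside the induction formula, because the successor step passes
     to its predecessor. *)
  set (P D (t : tm D O) := All O (deq (wk t) #0 == tzero ==> wk t == #0) : fm LHA D).
  assert (subP : forall D E (s : sub D E) (f : tm E O) (t : tm D O),
    sub_fm (L := LHA) (scons f s) (deq (wk t) #0 == tzero ==> wk t == #0)
    = (deq (sub_tm s t) f == tzero ==> sub_tm s t == f)).
  { intros; now autorewrite with sub. }
  enough (e : H ⊢ P _ x).
  { apply (allE y) in e. rewrite subP in e. now autorewrite with sub in e. }
  apply (@ind_sub _ H (fun D s t => P D t) (All O (deq #1 #0 == tzero ==> #1 == #0))).
  - intros D s t. cbn [sub_fm]. unfold P. now rewrite sub_deq.
  - apply allI. intros D s H' w t. rewrite subP. apply impI. intros H2 l.
    autorewrite with sub. intros d. change (eqv H2 tzero t). symmetry.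
    now rewrite <- deq0.
  - intros D s H' w m IH. apply allI. intros E f H2 w2 t. rewrite subP.
    (* The term is displayed as its own image under the identity, the shape that [ind_sub] expects;
       the inner induction separates zero from successors. *)
    rewrite sub_tsucc. set (m' := sub_tm f m). rewrite <- (sub_id m'). subst m'.
    apply (@ind_sub _ H2 (fun D s t => deq (tsucc (sub_tm s (sub_tm f m))) t == tzero ==>
         tsucc (sub_tm s (sub_tm f m)) == t)
      (deq (tsucc (wk (sub_tm f m))) #0 == tzero ==> tsucc (wk (sub_tm f m)) == #0)).
    + intros; now autorewrite with sub.
    + apply impI. intros H3 l d. apply prv_botE.
      refine (prv_impE (prv_ax _ (ax_succ_neq0 _ tzero)) _).
      change (eqv H3 (tsucc tzero) tzero).
      rewrite sub_id in d. now rewrite <- (deqS0 H3 (sub_tm f m)).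
    + intros E2 f2 H3 w3 n _. apply impI. intros H4 l d.
      change (eqv H4 (tsucc (sub_tm f2 (sub_tm f m))) (tsucc n)).
      apply (allE_wld n (wld_comp w2 (wld_later w3 l))) in IH. rewrite subP in IH.
      rewrite sub_sub in d |- *.
      assert (e : eqv H4 (sub_tm (comp f f2) m) n).
      { refine (prv_impE IH _). change (eqv H4 (deq (sub_tm (comp f f2) m) n) tzero).
        rewrite <- deqSS. exact d. }
      now rewrite e.
Qed.

Lemma eq_dec G (H : list (fm LHA G)) (x y : tm G O) : H ⊢ Or (x == y) (Not (x == y)).
Proof.
  apply (orE (zero_dec H (deq x y))); intros H' l d.
  - apply prv_orI1. exact (deq_eq d).
  - apply prv_orI2, notI. intros H2 l2 e. apply (notE _ (l2 _ d)).
    change (eqv H2 (deq x y) tzero). change (eqv H2 x y) in e. rewrite e. apply deq_refl.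
Qed.

Lemma eq_stable G H (x y : tm G O) : H ⊢ Not (Not (x == y)) -> eqv H x y.
Proof.
  intros d. apply (orE (eq_dec H x y)); intros H' l e; [exact e|].
  exact (notE _ (l _ d) e).
Qed.

Lemma tif_deq_neq G H a (x y : tm G O) (p q : tm G a) :
  H ⊢ Not (x == y) -> eqv H (tif (deq x y) p q) q.
Proof.
  intros d. apply tif_neq0, notI. intros H' l e. apply (notE _ (l _ d)). exact (deq_eq e).
Qed.

Lemma tif_deq_eq G H a (x y : tm G O) (p q : tm G a) :
  eqv H x y -> eqv H (tif (deq x y) p q) p.
Proof. intros d. apply tif0. rewrite d. apply deq_refl. Qed.

(** * Observations *)

(* For [z] fixed, [app a x y z] says that [x] and [y] differ at the observation
   [ev a _ z], provided that [z] is well-formed; see [app_neq] and [app_transfer]. *)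
Fixpoint ev (a : ty) : forall {G}, tm G (plus a) -> tm G (minus a) -> tm G O :=
  match a with
  | O => fun G x z => x
  | s ** t => fun G x (z : tm G (minus (s ** t))) =>
      tif (tsnd z) (ev (a := s) (tfst x) (tfst (tfst z))) (ev (a := t) (tsnd x) (tsnd (tfst z)))
  | s ~> t => fun G x (z : tm G (minus (s ~> t))) => ev (a := t) (star x (tfst z)) (tsnd z)
  end.
Arguments ev a {G} _ _.

Lemma sub_ev a G D (s : sub G D) x z : sub_tm s (ev a x z) = ev a (sub_tm s x) (sub_tm s z).
Proof. revert G D s x z. induction a; intros; cbn [ev]; autorewrite with sub;
  rewrite ?IHa1, ?IHa2; reflexivity. Qed.
#[local] Hint Rewrite sub_ev : sub.

Lemma app_neq a G H (x y : tm G (plus a)) z :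
  H ⊢ app a x y z -> H ⊢ Not (ev a x z == ev a y z).
Proof.
  revert G H x y z. induction a as [|a IHa b IHb|a IHa b IHb]; intros G H x y z d.
  - exact d.
  - cbn. apply notI. intros H' l e. apply l in d.
    change (H' ⊢ (tsnd z == tzero ==> app a (tfst x) (tfst y) (tfst (tfst z)))
      && (Not (tsnd z == tzero) ==> app b (tsnd x) (tsnd y) (tsnd (tfst z)))) in d.
    (* Once the tag of the observation is decided, both occurrences of [tif] in [ev] reduce to the
       same component. *)
    apply (orE (zero_dec H' (tsnd z))); intros H2 l2 f.
    + apply l2 in e. rewrite !(tif0 _ _ f) in e.
      eapply notE; [eapply IHa, prv_impE, f; eapply prv_andE1, l2, d | exact e].
    + apply l2 in e. rewrite !(tif_neq0 _ _ f) in e.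
      eapply notE; [eapply IHb, prv_impE, f; eapply prv_andE2, l2, d | exact e].
  - apply IHb. eapply prv_andE2, d.
Qed.

(** The first hypothesis supplies the domain conditions, which concern [z] alone; the second
    supplies the numerical inequality to which [app] finally comes down. *)
Lemma app_transfer a G H (x y x' y' : tm G (plus a)) z :
  H ⊢ app a x y z -> H ⊢ Not (ev a x' z == ev a y' z) -> H ⊢ app a x' y' z.
Proof.
  revert G H x y x' y' z. induction a as [|a IHa b IHb|a IHa b IHb]; intros G H x y x' y' z d e.
  - exact e.
  - apply prv_andI; apply impI; intros H' l f; apply l in d, e.
    + cbn in e. rewrite !(tif0 _ _ f) in e.
      eapply IHa, e. eapply prv_impE, f. eapply prv_andE1, d.
    + cbn in e. rewrite !(tif_neq0 _ _ f) in e.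
      eapply IHb, e. eapply prv_impE, f. eapply prv_andE2, d.
  - apply prv_andI; [eapply prv_andE1, d|]. eapply IHb, e. eapply prv_andE2, d.
Qed.

Lemma app_irrefl a G (H : list (fm LHA G)) x z q : H ⊢ app a x x z -> H ⊢ q.
Proof. intros d. apply app_neq in d. apply (notE _ d), prv_ax, ax_refl. Qed.

(** For [x'] lying between [x] and [y]: if [z] does not notice the passage from [x] to [x'], it must
    notice the one from [x'] to [y]. *)
Lemma app_split a G (H : list (fm LHA G)) x y x' z :
  H ⊢ app a x y z -> eqv H (ev a x z) (ev a x' z) -> H ⊢ app a x' y z.
Proof.
  intros d e. apply (app_transfer d). rewrite <- e. exact (app_neq d).
Qed.

(** A default inhabitant of each type, for positions of moduli and observations where any value will
    do. *)
Fixpoint tz G a : tm G a :=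
  match a with
  | O => tzero
  | a ** b => tpair (tz G a) (tz G b)
  | a ~> b => tk b a @ tz G b
  end.
Arguments tz {G} a.
Lemma sub_tz G D (s : sub G D) a : sub_tm s (tz a) = tz a.
Proof. induction a; cbn [tz]; autorewrite with sub; rewrite ?IHa1, ?IHa2; reflexivity. Qed.
#[local] Hint Rewrite sub_tz : sub.

(* Copies of the operations whose types mention [plus] and [minus] of the
   original type, which keeps unification from having to compute them. *)
Definition ppair G a b (x : tm G (plus a)) (y : tm G (plus b)) : tm G (plus (a ** b)) :=
  tpair x y.
Definition pfst G a b (x : tm G (plus (a ** b))) : tm G (plus a) := tfst (t := plus b) x.
Definition psnd G a b (x : tm G (plus (a ** b))) : tm G (plus b) := tsnd (s := plus a) x.
Definition apair G a b (x : tm G (plus a)) (w : tm G (minus b)) : tm G (minus (a ~> b)) :=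
  tpair x w.
Definition afst G a b (z : tm G (minus (a ~> b))) : tm G (plus a) := tfst (t := minus b) z.
Definition asnd G a b (z : tm G (minus (a ~> b))) : tm G (minus b) := tsnd (s := plus a) z.
(** An observation of a product holds one observation per component and a tag, zero choosing the
    first component and a successor the second. The component not chosen is padded with a
    default. *)
Definition minl G a b (z : tm G (minus a)) : tm G (minus (a ** b)) :=
  tpair (tpair z (tz (minus b))) tzero.
Definition minr G a b (z : tm G (minus b)) : tm G (minus (a ** b)) :=
  tpair (tpair (tz (minus a)) z) (tsucc tzero).
Definition mfst G a b (z : tm G (minus (a ** b))) : tm G (minus a) :=
  tfst (t := minus b) (tfst (t := O) z).
Definition msnd G a b (z : tm G (minus (a ** b))) : tm G (minus b) :=
  tsnd (s := minus a) (tfst (t := O) z).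
Definition mtag G a b (z : tm G (minus (a ** b))) : tm G O :=
  tsnd (s := minus a ** minus b) z.

#[local] Instance pfst_proper G H a b : Proper (respectful (eqv H) (eqv H)) (@pfst G a b).
Proof. intros x x' d. unfold pfst. now rewrite d. Qed.
#[local] Instance psnd_proper G H a b : Proper (respectful (eqv H) (eqv H)) (@psnd G a b).
Proof. intros x x' d. unfold psnd. now rewrite d. Qed.
Lemma pfst_pair G H a b (x : tm G (plus a)) (y : tm G (plus b)) : eqv H (pfst (ppair x y)) x.
Proof. apply fst_pair. Qed.
Lemma psnd_pair G H a b (x : tm G (plus a)) (y : tm G (plus b)) : eqv H (psnd (ppair x y)) y.
Proof. apply snd_pair. Qed.
Lemma afst_pair G H a b (x : tm G (plus a)) (w : tm G (minus b)) : eqv H (afst (apair x w)) x.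
Proof. apply fst_pair. Qed.
Lemma asnd_pair G H a b (x : tm G (plus a)) (w : tm G (minus b)) : eqv H (asnd (apair x w)) w.
Proof. apply snd_pair. Qed.

Lemma sub_ppair G D (s : sub G D) a b (x : tm G (plus a)) (y : tm G (plus b)) :
  sub_tm s (ppair x y) = ppair (sub_tm s x) (sub_tm s y).
Proof. reflexivity. Qed.
Lemma sub_apair G D (s : sub G D) a b (x : tm G (plus a)) (y : tm G (minus b)) :
  sub_tm s (apair x y) = apair (sub_tm s x) (sub_tm s y).
Proof. reflexivity. Qed.
Lemma sub_pfst G D (s : sub G D) a b (x : tm G (plus (a ** b))) :
  sub_tm s (pfst x) = pfst (sub_tm s x).
Proof. reflexivity. Qed.
Lemma sub_psnd G D (s : sub G D) a b (x : tm G (plus (a ** b))) :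
  sub_tm s (psnd x) = psnd (sub_tm s x).
Proof. reflexivity. Qed.
Lemma sub_afst G D (s : sub G D) a b (x : tm G (minus (a ~> b))) :
  sub_tm s (afst x) = afst (sub_tm s x).
Proof. reflexivity. Qed.
Lemma sub_asnd G D (s : sub G D) a b (x : tm G (minus (a ~> b))) :
  sub_tm s (asnd x) = asnd (sub_tm s x).
Proof. reflexivity. Qed.
Lemma sub_mfst G D (s : sub G D) a b (x : tm G (minus (a ** b))) :
  sub_tm s (mfst x) = mfst (sub_tm s x).
Proof. reflexivity. Qed.
Lemma sub_msnd G D (s : sub G D) a b (x : tm G (minus (a ** b))) :
  sub_tm s (msnd x) = msnd (sub_tm s x).
Proof. reflexivity. Qed.
Lemma sub_minl G D (s : sub G D) a b z : sub_tm s (minl (a := a) b z) = minl b (sub_tm s z).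
Proof. unfold minl. now rewrite <- (sub_tz s). Qed.
Lemma sub_minr G D (s : sub G D) a b z : sub_tm s (minr a (b := b) z) = minr a (sub_tm s z).
Proof. unfold minr. now rewrite <- (sub_tz s). Qed.
#[local] Hint Rewrite sub_ppair sub_apair sub_pfst sub_psnd sub_afst sub_asnd sub_mfst sub_msnd
  sub_minl sub_minr : sub.

(** * Functions with moduli; introduction and elimination for [dom] and [app] *)

Definition md G a b (x : tm G (plus (a ~> b))) u v w : tm G (minus a) :=
  tsnd (x : tm G ((plus a ~> plus b) ** (plus a ~> plus a ~> minus b ~> minus a))) @ u @ v @ w.
Lemma sub_md G D (s : sub G D) a b (x : tm G (plus (a ~> b))) u v w :
  sub_tm s (md x u v w) = md (sub_tm s x) (sub_tm s u) (sub_tm s v) (sub_tm s w).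
Proof. reflexivity. Qed.
#[local] Hint Rewrite sub_md : sub.

(* The function [u |-> t] with modulus [u, v, w |-> m], so that in [m] the variable
   [#0] is the observation of the values at [#2] and [#1]. *)
Definition fnc G a b (t : tm (plus a :: G) (plus b))
    (m : tm (minus b :: plus a :: plus a :: G) (minus a)) : tm G (plus (a ~> b)) :=
  tpair (lam t) (lam (lam (lam m))).

Lemma star_fnc G D H (s : sub G D) a b (t : tm (plus a :: G) (plus b)) m u :
  eqv H (star (sub_tm s (fnc t m)) u) (sub_tm (scons u s) t).
Proof.
  rewrite <- beta. unfold star. apply App_proper; [|reflexivity]. apply fst_pair.
Qed.

Lemma md_fnc G D H (s : sub G D) a b (t : tm (plus a :: G) (plus b)) m u v w :
  eqv H (md (sub_tm s (fnc t m)) u v w) (sub_tm (scons w (scons v (scons u s))) m).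
Proof.
  rewrite <- !beta. unfold md. repeat (apply App_proper; [|reflexivity]). apply snd_pair.
Qed.
#[global] Opaque fnc.

Lemma dom_star G (H : list (fm LHA G)) a b x u :
  H ⊢ dom (a ~> b) x -> H ⊢ dom a u -> H ⊢ dom b (star x u).
Proof.
  intros d e. apply prv_andE1 in d. apply (allE u) in d.
  rewrite sub_Imp, !sub_dom in d. autorewrite with sub in d. exact (prv_impE d e).
Qed.

Lemma dom_md G (H : list (fm LHA G)) a b x u v w : H ⊢ dom (a ~> b) x ->
  H ⊢ dom a u -> H ⊢ dom a v -> H ⊢ app b (star x u) (star x v) w ->
  H ⊢ app a u v (md x u v w).
Proof.
  intros d eu ev ew. apply prv_andE2 in d.
  apply (all3E u v w) in d. autorewrite with sub in d.
  exact (prv_impE (prv_impE (prv_impE d eu) ev) ew).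
Qed.

(** The interpretations of curried constants nest [fnc], and the inner one appears as a closure
    [sub_tm s (fnc t m)] that cannot be pushed inwards; hence the statement for an arbitrary
    environment [s]. *)
Lemma dom_fncI G0 G (s : sub G0 G) (H : list (fm LHA G)) a b t m :
  (forall D (f : sub G D) H', wld f H H' -> forall u, H' ⊢ dom a u ->
    H' ⊢ dom b (sub_tm (scons u (comp s f)) t)) ->
  (forall D (f : sub G D) H', wld f H H' -> forall u v w, H' ⊢ dom a u -> H' ⊢ dom a v ->
    H' ⊢ app b (sub_tm (scons u (comp s f)) t) (sub_tm (scons v (comp s f)) t) w ->
    H' ⊢ app a u v (sub_tm (scons w (scons v (scons u (comp s f)))) m)) ->
  H ⊢ dom (a ~> b) (sub_tm s (fnc t m)).
Proof.
  intros h1 h2. apply prv_andI.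
  - apply allI. intros D f H' w u. autorewrite with sub. apply impI. intros H2 l d.
    rewrite sub_sub, star_fnc. apply h1; [apply (wld_later w l) | exact d].
  - apply all3I. intros D f H' W u v w. autorewrite with sub. rewrite sub_sub.
    apply impI; intros H1 l1 eu. apply impI; intros H2 l2 ev. apply impI; intros H3 l3 ew.
    rewrite !star_fnc in ew.
    change (H3 ⊢ app a u v (md (sub_tm (comp s f) (fnc t m)) u v w)). rewrite md_fnc.
    apply h2; auto. eauto using wld_later, later_trans.
Qed.

Lemma dom_prodI G (H : list (fm LHA G)) a b x y :
  H ⊢ dom a x -> H ⊢ dom b y -> H ⊢ dom (a ** b) (ppair x y).
Proof.
  intros d e. apply prv_andI.
  - change (H ⊢ dom a (pfst (ppair x y))). now rewrite pfst_pair.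
  - change (H ⊢ dom b (psnd (ppair x y))). now rewrite psnd_pair.
Qed.

Lemma dom_fst G (H : list (fm LHA G)) a b x : H ⊢ dom (a ** b) x -> H ⊢ dom a (pfst x).
Proof. apply prv_andE1. Qed.
Lemma dom_snd G (H : list (fm LHA G)) a b x : H ⊢ dom (a ** b) x -> H ⊢ dom b (psnd x).
Proof. apply prv_andE2. Qed.

Lemma app_arrE G (H : list (fm LHA G)) a b x y z :
  H ⊢ app (a ~> b) x y z -> (H ⊢ dom a (afst z)) /\
  (H ⊢ app b (star x (afst z)) (star y (afst z)) (asnd z)).
Proof. intros d. split; [eapply prv_andE1, d | eapply prv_andE2, d]. Qed.

Lemma app_arrI G (H : list (fm LHA G)) a b x y u w :
  H ⊢ dom a u -> H ⊢ app b (star x u) (star y u) w -> H ⊢ app (a ~> b) x y (apair u w).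
Proof.
  intros d e. apply prv_andI.
  - change (H ⊢ dom a (afst (apair u w))). now rewrite afst_pair.
  - change (H ⊢ app b (star x (afst (apair u w))) (star y (afst (apair u w)))
      (asnd (apair u w))). now rewrite afst_pair, asnd_pair.
Qed.

Lemma app_prodE G (H : list (fm LHA G)) a b x y z : H ⊢ app (a ** b) x y z ->
  (H ⊢ mtag z == tzero ==> app a (pfst x) (pfst y) (mfst z)) /\
  (H ⊢ Not (mtag z == tzero) ==> app b (psnd x) (psnd y) (msnd z)).
Proof. intros d. split; [eapply prv_andE1, d | eapply prv_andE2, d]. Qed.

(** The first components coincide and [app] is irreflexive, so the tag of [z] cannot be zero. *)
Lemma app_pair_snd G (H : list (fm LHA G)) a b x y y' z :
  H ⊢ app (a ** b) (ppair x y) (ppair x y') z -> H ⊢ app b y y' (msnd z).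
Proof.
  intros d. apply app_prodE in d as [d1 d2]. rewrite !pfst_pair in d1. rewrite !psnd_pair in d2.
  apply (prv_impE d2). apply notI. intros H' l e.
  apply l in d1. exact (app_irrefl _ (prv_impE d1 e)).
Qed.

Lemma app_pair_fst G (H : list (fm LHA G)) a b x x' y z :
  H ⊢ app (a ** b) (ppair x y) (ppair x' y) z -> H ⊢ app a x x' (mfst z).
Proof.
  intros d. apply app_prodE in d as [d1 d2]. rewrite !pfst_pair in d1. rewrite !psnd_pair in d2.
  (* Irreflexivity only refutes that the tag is nonzero; stability of numerical equality turns this
     into a zero tag. *)
  apply (prv_impE d1). apply eq_stable, notI. intros H' l e.
  apply l in d2. exact (app_irrefl _ (prv_impE d2 e)).
Qed.

Lemma app_minl G (H : list (fm LHA G)) a b (x y : tm G (plus (a ** b))) z :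
  H ⊢ app a (pfst x) (pfst y) z -> H ⊢ app (a ** b) x y (minl b z).
Proof.
  intros d.
  assert (e : eqv H (mfst (minl b z)) z) by (unfold mfst, minl; now rewrite !fst_pair).
  apply prv_andI; apply impI; intros H' l f; apply l in d; apply (eqv_later l) in e.
  - change (H' ⊢ app a (pfst x) (pfst y) (mfst (minl b z))). now rewrite e.
  - apply (notE _ f), snd_pair.
Qed.

Lemma app_minr G (H : list (fm LHA G)) a b (x y : tm G (plus (a ** b))) z :
  H ⊢ app b (psnd x) (psnd y) z -> H ⊢ app (a ** b) x y (minr a z).
Proof.
  intros d.
  assert (e : eqv H (msnd (minr a z)) z) by (unfold msnd, minr; now rewrite fst_pair, snd_pair).
  apply prv_andI; apply impI; intros H' l f; apply l in d; apply (eqv_later l) in e.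
  - refine (notE _ (prv_ax _ (ax_succ_neq0 _ tzero)) _).
    change (eqv H' (tsucc tzero) tzero). rewrite <- (snd_pair H' (tpair (tz (minus a)) z)).
    exact f.
  - change (H' ⊢ app b (psnd x) (psnd y) (msnd (minr a z))). now rewrite e.
Qed.

(* Carries the hypotheses along [W : wld f H H'] and then forgets how they arose,
   by generalizing each term [sub_tm f u]. *)
Ltac push W := unfold eqv in *;
  match type of W with wld ?f ?H _ =>
    repeat match goal with h : prv _ H _ |- _ => apply W in h; autorewrite with sub in h end;
    clear W;
    repeat match goal with u : tm _ _ |- _ =>
      match goal with |- context[sub_tm f u] =>
        let v := fresh "v" in set (v := sub_tm f u) in *; clearbody v; clear u; rename v into u
      | _ : context[sub_tm f u] |- _ =>
        let v := fresh "v" in set (v := sub_tm f u) in *; clearbody v; clear u; rename v into u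
      end end; try clear f
  end.

Ltac sb := autorewrite with sub in *.

(** * The constants other than the recursor *)

(** An observation of a function of type [b ~> a] is an argument with an observation of the value
    there; for constant functions the latter already separates the two constants. The inner
    function, being constant, is never separated from itself, so its modulus is a default. *)
Definition kα a b : tm nil (plus (a ~> b ~> a)) :=
  fnc (b := b ~> a) (fnc #1 (tz _)) (asnd (a := b) #0).

(** When [z] changes to [z'], the value x z (y z) becomes x z' (y z') by way of x z (y z'). If the
    observation does not notice the first passage, the modulus of [x] treats the second; otherwise
    the modulus of x z, followed by that of [y], treats the first. The moduli for changes of [y] and
    of [x] merely rearrange the observation or apply the modulus of x z. *)
Definition sα a b c : tm nil (plus ((a ~> b ~> c) ~> (a ~> b) ~> a ~> c)) :=
  fnc (b := (a ~> b) ~> a ~> c)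
    (fnc (b := a ~> c)
      (fnc (star (star (b := b ~> c) #2 #0) (star #1 #0))
        (tif (deq (ev c (star (star (b := b ~> c) #4 #2) (star #3 #2)) #0)
                  (ev c (star (star (b := b ~> c) #4 #2) (star #3 #1)) #0))
          (md (b := b ~> c) #4 #2 #1 (apair (star #3 #1) #0))
          (md #3 #2 #1 (md (star (b := b ~> c) #4 #2) (star #3 #2) (star #3 #1) #0))))
      (let z := afst (a := a) (b := c) #0 in
       apair z (md (star (b := b ~> c) #3 z) (star #2 z) (star #1 z)
         (asnd (a := a) (b := c) #0))))
    (let y := afst (a := a ~> b) (b := a ~> c) #0 in
     let zw := asnd (a := a ~> b) (b := a ~> c) #0 in
     apair (b := b ~> c) (afst zw) (apair (star y (afst zw)) (asnd zw))).

Definition pairα a b : tm nil (plus (a ~> b ~> a ** b)) :=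
  fnc (b := b ~> a ** b) (fnc (b := a ** b) (ppair #1 #0) (msnd (a := a) (b := b) #0))
    (mfst (asnd (a := b) (b := a ** b) #0)).

Definition fstα a b : tm nil (plus (a ** b ~> a)) :=
  fnc (a := a ** b) (pfst (a := a) (b := b) #0) (minl b #0).
Definition sndα a b : tm nil (plus (a ** b ~> b)) :=
  fnc (a := a ** b) (psnd (a := a) (b := b) #0) (minr a #0).
Definition succα : tm nil (plus (O ~> O)) := fnc (a := O) (b := O) (tsucc #0) (tz O).

Lemma dom_k a b G (H : list (fm LHA G)) : H ⊢ dom _ (closed (kα a b)).
Proof.
  rewrite closedE. apply dom_fncI.
  - intros D f H' W u d. sb. apply dom_fncI.
    + intros D2 f2 H2 W2 v e. sb. push W2. exact d.
    + intros D2 f2 H2 W2 v v' w e e' g. sb. push W2. exact (app_irrefl _ g).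
  - intros D f H' W u v w d e g. sb. apply app_arrE in g as [g1 g2].
    rewrite !star_fnc in g2. sb. exact g2.
Qed.

Lemma dom_s a b c G (H : list (fm LHA G)) : H ⊢ dom _ (closed (sα a b c)).
Proof.
  rewrite closedE. apply dom_fncI.
  - intros D f H' W x dx. sb. apply dom_fncI.
    + intros D2 f2 H2 W2 y dy. sb. apply dom_fncI.
      * intros D3 f3 H3 W3 z dz. sb. push W2. push W3. eauto using dom_star.
      * intros D3 f3 H3 W3 z z' w dz dz' e. sb. push W2. push W3.
        apply (orE (eq_dec H3 (ev c (star (star (b := b ~> c) x z) (star y z)) w)
                  (ev c (star (star (b := b ~> c) x z) (star y z')) w))); intros H4 l g;
          apply l in dx, dy, dz, dz', e; clear l.
        -- rewrite (tif_deq_eq _ _ g).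
           apply (dom_md dx); auto. apply app_arrI; eauto using dom_star.
           exact (app_split e g).
        -- rewrite (tif_deq_neq _ _ g).
           apply (dom_md dy); auto. apply (dom_md (dom_star dx dz)); eauto using dom_star.
           exact (app_transfer e g).
    + intros D2 f2 H2 W2 y y' w dy dy' e. sb. push W2. apply app_arrE in e as [dz e].
      rewrite !star_fnc in e. sb.
      apply app_arrI; [exact dz|].
      apply (dom_md (dom_star dx dz)); eauto using dom_star.
  - intros D f H' W x x' w dx dx' e. sb. apply app_arrE in e as [dy e].
    apply app_arrE in e as [dz e]. rewrite !star_fnc in e. sb.
    apply app_arrI; [exact dz|]. apply app_arrI; eauto using dom_star.
Qed.

Lemma dom_pair a b G (H : list (fm LHA G)) : H ⊢ dom _ (closed (pairα a b)).
Proof.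
  rewrite closedE. apply dom_fncI.
  - intros D f H' W x dx. sb. apply dom_fncI.
    + intros D2 f2 H2 W2 y dy. sb. push W2. now apply dom_prodI.
    + intros D2 f2 H2 W2 y y' w dy dy' e. sb. push W2.
      exact (app_pair_snd e).
  - intros D f H' W x x' w dx dx' e. sb. apply app_arrE in e as [dy e].
    rewrite !star_fnc in e. sb.
    exact (app_pair_fst e).
Qed.

Lemma dom_fstα a b G (H : list (fm LHA G)) : H ⊢ dom _ (closed (fstα a b)).
Proof.
  rewrite closedE. apply dom_fncI.
  - intros D f H' W x dx. sb. now apply dom_fst.
  - intros D f H' W x x' w dx dx' e. sb. now apply app_minl.
Qed.

Lemma dom_sndα a b G (H : list (fm LHA G)) : H ⊢ dom _ (closed (sndα a b)).
Proof.
  rewrite closedE. apply dom_fncI.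
  - intros D f H' W x dx. sb. now apply dom_snd.
  - intros D f H' W x x' w dx dx' e. sb. now apply app_minr.
Qed.

Lemma dom_O G (H : list (fm LHA G)) x : H ⊢ dom O x.
Proof. apply impI. auto. Qed.

Lemma app_O_neq G (H : list (fm LHA G)) (x y z : tm G O) : H ⊢ Not (x == y) -> H ⊢ app O x y z.
Proof. exact id. Qed.

Lemma dom_succ G (H : list (fm LHA G)) : H ⊢ dom _ (closed succα).
Proof.
  rewrite closedE. apply dom_fncI.
  - intros. apply dom_O.
  - intros D f H' W x x' w dx dx' e. sb. apply app_O_neq. apply notI. intros H2 l g.
    apply (notE _ (l _ e)). change (eqv H2 (tsucc x) (tsucc x')). change (eqv H2 x x') in g.
    now rewrite g.
Qed.

(** * The recursor *)

(** The underlying function of the recursor. It is packaged as a closed term so that it commutes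
    with substitution, which an open [lam] does not; the moduli below follow the same pattern. *)
Definition trcC a : tm nil (plus a ~> plus (O ~> a ~> a) ~> O ~> plus a) :=
  lam (lam (trec _ @ #1 @ lam (lam (star (star (a := O) (b := a ~> a) #2 #1) #0)))).
Definition trc G a (x : tm G (plus a)) (y : tm G (plus (O ~> a ~> a))) (m : tm G O)
  : tm G (plus a) := closed (trcC a) @ x @ y @ m.
#[local] Instance trc_proper G H a : Proper (respectful (eqv H) (respectful (eqv H)
  (respectful (eqv H) (eqv H)))) (@trc G a).
Proof. intros x x' d y y' e z z' f. unfold trc. now rewrite d, e, f. Qed.
Lemma sub_trc G D (s : sub G D) a x y m :
  sub_tm s (trc (a := a) x y m) = trc (sub_tm s x) (sub_tm s y) (sub_tm s m).
Proof. unfold trc. now autorewrite with sub. Qed.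
#[local] Hint Rewrite sub_trc : sub.

Lemma trc0 G H a (x : tm G (plus a)) y : eqv H (trc x y tzero) x.
Proof. unfold trc, trcC. nrm. reflexivity. Qed.
Lemma trcS G H a (x : tm G (plus a)) y m :
  eqv H (trc x y (tsucc m)) (star (star (a := O) (b := a ~> a) y m) (trc x y m)).
Proof. unfold trc, trcC. nrm. reflexivity. Qed.

(* [rmod1 x x' y m] moves an observation separating [trc x y m] from [trc x' y m]
   down the recursion to one separating [x] from [x']. *)
Definition rmod1C a
  : tm nil (plus a ~> plus a ~> plus (O ~> a ~> a) ~> O ~> minus a ~> minus a) :=
  lam (lam (lam (prim #0
    (#1 @ md (star (a := O) (b := a ~> a) #3 #2) (trc #5 #3 #2) (trc #4 #3 #2) #0)))).
Definition rmod1 G a (x x' : tm G (plus a)) y m w : tm G (minus a) :=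
  closed (rmod1C a) @ x @ x' @ y @ m @ w.
Lemma sub_rmod1 G D (s : sub G D) a x x' y m w : sub_tm s (rmod1 (a := a) x x' y m w)
  = rmod1 (sub_tm s x) (sub_tm s x') (sub_tm s y) (sub_tm s m) (sub_tm s w).
Proof. unfold rmod1. now autorewrite with sub. Qed.
#[local] Hint Rewrite sub_rmod1 : sub.

Lemma rmod1_0 G H a (x x' : tm G (plus a)) y w : eqv H (rmod1 x x' y tzero w) w.
Proof. unfold rmod1, rmod1C. now rewrite beta0, !beta, prim0. Qed.
Lemma rmod1_S G H a (x x' : tm G (plus a)) y m w :
  eqv H (rmod1 x x' y (tsucc m) w)
    (rmod1 x x' y m (md (star (a := O) (b := a ~> a) y m) (trc x y m) (trc x' y m) w)).
Proof.
  unfold rmod1, rmod1C. rewrite beta0, !beta, primS. now autorewrite with sub.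
Qed.

(* Searches downwards for a step [m] at which [y] and [y'] disagree on the argument
   [trc x y m]. *)
Definition rmod2C a : tm nil (plus a ~> plus (O ~> a ~> a) ~> plus (O ~> a ~> a) ~>
    O ~> minus a ~> minus (O ~> a ~> a)) :=
  lam (lam (lam (prim (tz _)
    (let yn := star (a := O) (b := a ~> a) #4 #2 in
     let yn' := star (a := O) (b := a ~> a) #3 #2 in
     tif (deq (ev a (star yn (trc #5 #4 #2)) #0) (ev a (star yn' (trc #5 #4 #2)) #0))
      (#1 @ md yn' (trc #5 #4 #2) (trc #5 #3 #2) #0)
      (apair (a := O) (b := a ~> a) #2 (apair (trc #5 #4 #2) #0)))))).
Definition rmod2 G a (x : tm G (plus a)) y y' m w : tm G (minus (O ~> a ~> a)) :=
  closed (rmod2C a) @ x @ y @ y' @ m @ w.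
Lemma sub_rmod2 G D (s : sub G D) a x y y' m w : sub_tm s (rmod2 (a := a) x y y' m w)
  = rmod2 (sub_tm s x) (sub_tm s y) (sub_tm s y') (sub_tm s m) (sub_tm s w).
Proof. unfold rmod2. now autorewrite with sub. Qed.
#[local] Hint Rewrite sub_rmod2 : sub.

Lemma rmod2_S G H a (x : tm G (plus a)) y y' m w :
  let yn := star (a := O) (b := a ~> a) y m in
  let yn' := star (a := O) (b := a ~> a) y' m in
  eqv H (rmod2 x y y' (tsucc m) w)
    (tif (deq (ev a (star yn (trc x y m)) w) (ev a (star yn' (trc x y m)) w))
      (rmod2 x y y' m (md yn' (trc x y m) (trc x y' m) w))
      (apair (a := O) (b := a ~> a) m (apair (trc x y m) w))).
Proof.
  intros yn yn'. unfold rmod2, rmod2C. rewrite beta0, !beta, primS.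
  cbv zeta. now autorewrite with sub.
Qed.

(** Changes of the initial value are traced by [rmod1] and changes of the step function by [rmod2].
    Two numbers are separated by any observation as soon as they differ, so the modulus in the
    numerical argument is a default. *)
Definition recα a : tm nil (plus (a ~> (O ~> a ~> a) ~> O ~> a)) :=
  fnc (b := (O ~> a ~> a) ~> O ~> a)
    (fnc (b := O ~> a) (fnc (a := O) (b := a) (trc #2 #1 #0) (tz O))
      (rmod2 #3 #2 #1 (afst (a := O) (b := a) #0) (asnd (a := O) (b := a) #0)))
    (let y := afst (a := O ~> a ~> a) (b := O ~> a) #0 in
     let z := asnd (a := O ~> a ~> a) (b := O ~> a) #0 in
     rmod1 #2 #1 y (afst (a := O) (b := a) z) (asnd (a := O) (b := a) z)).

Lemma dom_trc G (H : list (fm LHA G)) a x y m :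
  H ⊢ dom a x -> H ⊢ dom (O ~> a ~> a) y -> H ⊢ dom a (trc x y m).
Proof.
  intros dx dy.
  (* The parameters are displayed as substitution instances so that they can travel with the worlds
     of the induction. *)
  rewrite <- (sub_id x), <- (sub_id y).
  apply (@ind_sub _ H (fun D s t => dom a (trc (sub_tm s x) (sub_tm s y) t))
    (dom a (trc (wk x) (wk y) #0))).
  - intros; now autorewrite with sub.
  - rewrite trc0. now autorewrite with sub.
  - intros D s H' W n IH. rewrite trcS. push W.
    eapply dom_star; [|exact IH]. eapply dom_star; [eassumption | apply dom_O].
Qed.

(** Induction uniform in a second argument [w]. The moduli of the recursor need this, since they
    hand a transformed observation to the predecessor stage. *)
Lemma ind_all G (H : list (fm LHA G)) c
    (Q : forall D, sub G D -> tm D O -> tm D c -> fm LHA D) (q : fm LHA (c :: O :: G)) :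
  (forall D s t w, sub_fm (scons w (scons t s)) q = Q D s t w) ->
  (forall D s H', wld s H H' -> forall w, H' ⊢ Q D s tzero w) ->
  (forall D s H', wld s H H' -> forall m, (forall w, H' ⊢ Q D s m w) ->
    forall w, H' ⊢ Q D s (tsucc m) w) ->
  forall t w, H ⊢ Q G (fun _ x => Var x) t w.
Proof.
  intros e h0 hS t w.
  assert (e' : forall D E (s : sub G D) (f : sub D E) t w,
    sub_fm (scons w f) (sub_fm (up_sub (scons t s)) q) = Q E (comp s f) (sub_tm f t) w).
  { intros D E s f t' w'. rewrite <- e, sub_sub_fm. apply sub_fm_seq. unfold seq.
    apply var_case; [reflexivity|]. intros a x.
    revert a x. apply var_case; [|intros a x]; unfold comp; cbn; now rewrite sub_wk. }
  assert (d : H ⊢ sub_fm (scons t (fun _ x => Var x)) (All c q)).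
  { apply ind.
    - apply allI. intros D s H' W u. rewrite e'. apply h0, W.
    - intros D s H' W m IH. apply allI. intros E f H2 W2 u. rewrite e'.
      rewrite sub_tsucc. apply (hS _ _ _ (wld_comp W W2)).
      intros u'. rewrite <- e'. apply (allE_wld u' W2 IH). }
  apply (allE w) in d. rewrite e' in d. unfold comp in d.
  rewrite sub_id in d. exact d.
Qed.

(** At a successor both values arise by applying the same function y m, whose modulus pulls the
    observation back to stage [m]; at zero the values are [x] and [x'] themselves. *)
Lemma app_rmod1 G (H : list (fm LHA G)) a x x' y m w :
  H ⊢ dom a x -> H ⊢ dom a x' -> H ⊢ dom (O ~> a ~> a) y ->
  H ⊢ app a (trc x y m) (trc x' y m) w -> H ⊢ app a x x' (rmod1 x x' y m w).
Proof.
  intros dx dx' dy d. refine (prv_impE _ d). clear d.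
  rewrite <- (sub_id x), <- (sub_id x'), <- (sub_id y).
  apply (@ind_all _ H (minus a) (fun D s m w =>
      app a (trc (sub_tm s x) (sub_tm s y) m) (trc (sub_tm s x') (sub_tm s y) m) w ==>
      app a (sub_tm s x) (sub_tm s x')
        (rmod1 (sub_tm s x) (sub_tm s x') (sub_tm s y) m w))
    (app a (trc (wk (wk x)) (wk (wk y)) #1) (trc (wk (wk x')) (wk (wk y)) #1) #0 ==>
      app a (wk (wk x)) (wk (wk x')) (rmod1 (wk (wk x)) (wk (wk x')) (wk (wk y)) #1 #0)));
    clear m w.
  - intros; now autorewrite with sub.
  - intros D s H' W w. apply impI. intros H2 l d. rewrite rmod1_0. now rewrite !trc0 in d.
  - intros D s H' W m IH w. push W. apply impI. intros H2 l d.
    rewrite rmod1_S. rewrite !trcS in d. refine (prv_impE (l _ (IH _)) _).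
    apply (dom_md (b := a)); [|apply l, dom_trc; assumption..|exact d].
    apply l. eapply dom_star; [exact dy | apply dom_O].
Qed.

(** At a successor the intermediate value is y' m applied to [trc x y m]. If [w] separates it from
    the first value, then [m], [trc x y m] and [w] form the required observation; otherwise the
    modulus of y' m moves the difference down to stage [m]. The search cannot end at zero, where
    both values are [x]. *)
Lemma app_rmod2 G (H : list (fm LHA G)) a x y y' m w :
  H ⊢ dom a x -> H ⊢ dom (O ~> a ~> a) y -> H ⊢ dom (O ~> a ~> a) y' ->
  H ⊢ app a (trc x y m) (trc x y' m) w -> H ⊢ app (O ~> a ~> a) y y' (rmod2 x y y' m w).
Proof.
  intros dx dy dy' d. refine (prv_impE _ d). clear d.
  rewrite <- (sub_id x), <- (sub_id y), <- (sub_id y').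
  apply (@ind_all _ H (minus a) (fun D s m w =>
      app a (trc (sub_tm s x) (sub_tm s y) m) (trc (sub_tm s x) (sub_tm s y') m) w ==>
      app (O ~> a ~> a) (sub_tm s y) (sub_tm s y')
        (rmod2 (sub_tm s x) (sub_tm s y) (sub_tm s y') m w))
    (app a (trc (wk (wk x)) (wk (wk y)) #1) (trc (wk (wk x)) (wk (wk y')) #1) #0 ==>
      app (O ~> a ~> a) (wk (wk y)) (wk (wk y'))
        (rmod2 (wk (wk x)) (wk (wk y)) (wk (wk y')) #1 #0)));
    clear m w.
  - intros; now autorewrite with sub.
  - intros D s H' W w. apply impI. intros H2 l d. rewrite !trc0 in d. exact (app_irrefl _ d).
  - intros D s H' W m IH w. push W. apply impI. intros H2 l d.
    rewrite rmod2_S. rewrite !trcS in d.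
    apply (orE (eq_dec H2 (ev a (star (star (a := O) (b := a ~> a) y m) (trc x y m)) w)
      (ev a (star (star (a := O) (b := a ~> a) y' m) (trc x y m)) w)));
      intros H3 l' e; apply l' in d; assert (L := later_trans l l'); clear l l'.
    + rewrite (tif_deq_eq _ _ e). refine (prv_impE (L _ (IH _)) _).
      apply (dom_md (b := a)); [|apply L, dom_trc; assumption..|exact (app_split d e)].
      apply L. eapply dom_star; [exact dy' | apply dom_O].
    + rewrite (tif_deq_neq _ _ e). apply app_arrI; [apply dom_O|].
      apply app_arrI; [apply L, dom_trc; assumption|]. exact (app_transfer d e).
Qed.

Lemma dom_rec a G (H : list (fm LHA G)) : H ⊢ dom _ (closed (recα a)).
Proof.
  rewrite closedE. apply dom_fncI.
  - intros D f H' W x dx. sb. apply dom_fncI.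
    + intros D2 f2 H2 W2 y dy. sb. apply dom_fncI.
      * intros D3 f3 H3 W3 m _. sb. push W2. push W3. now apply dom_trc.
      * intros D3 f3 H3 W3 m m' w _ _ e. sb. push W2. push W3.
        (* Equal numbers would make [w] separate a value from itself. *)
        apply app_O_neq, notI. intros H4 l g. apply l in e. change (eqv H4 m m') in g.
        rewrite g in e. exact (app_irrefl _ e).
    + intros D2 f2 H2 W2 y y' w dy dy' e. sb. push W2. apply app_arrE in e as [_ e].
      rewrite !star_fnc in e. sb. now apply app_rmod2.
  - intros D f H' W x x' w dx dx' e. sb. apply app_arrE in e as [dy e].
    apply app_arrE in e as [_ e]. rewrite !star_fnc in e. sb. now apply app_rmod1.
Qed.

(** * Soundness *)

Definition interp : const_interp := fun a c =>
  match c in const a return tm nil (plus a) with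
  | cK r s => kα r s
  | cS r s t => sα r s t
  | cPair s t => pairα s t
  | cFst s t => fstα s t
  | cSnd s t => sndα s t
  | cZero => tzero
  | cSucc => succα
  | cRec s => recα s
  end.

Lemma dom_const a (c : const a) G (H : list (fm LHA G)) : H ⊢ dom a (closed (interp c)).
Proof.
  destruct c; cbn [interp]; [apply dom_k | apply dom_s | apply dom_pair | apply dom_fstα
    | apply dom_sndα | apply dom_O | apply dom_succ | apply dom_rec].
Qed.

(** * Computation rules of the interpreted constants *)

Lemma kα_eq G (H : list (fm LHA G)) a b x y :
  eqv H (star (star (b := b ~> a) (closed (kα a b)) x) y) x.
Proof. unfold kα. rewrite closedE, !star_fnc. now autorewrite with sub. Qed.

Lemma sα_eq G (H : list (fm LHA G)) a b c x y z :
  eqv H (star (star (b := a ~> c) (star (b := (a ~> b) ~> a ~> c) (closed (sα a b c)) x) y) z)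
    (star (star (b := b ~> c) x z) (star y z)).
Proof. unfold sα. rewrite closedE, !star_fnc. now autorewrite with sub. Qed.

Lemma pairα_eq G (H : list (fm LHA G)) a b x y :
  eqv H (star (star (b := b ~> a ** b) (closed (pairα a b)) x) y) (ppair x y).
Proof. unfold pairα. rewrite closedE, !star_fnc. now autorewrite with sub. Qed.

Lemma fstα_eq G (H : list (fm LHA G)) a b x :
  eqv H (star (a := a ** b) (closed (fstα a b)) x) (pfst x).
Proof. unfold fstα. rewrite closedE, !star_fnc. now autorewrite with sub. Qed.

Lemma sndα_eq G (H : list (fm LHA G)) a b x :
  eqv H (star (a := a ** b) (closed (sndα a b)) x) (psnd x).
Proof. unfold sndα. rewrite closedE, !star_fnc. now autorewrite with sub. Qed.

Lemma succα_eq G (H : list (fm LHA G)) x :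
  eqv H (star (a := O) (b := O) (closed succα) x) (tsucc x).
Proof. unfold succα. rewrite closedE, !star_fnc. now autorewrite with sub. Qed.

Lemma recα_eq G (H : list (fm LHA G)) a x y m :
  eqv H (star (a := O) (b := a) (star (b := O ~> a)
    (star (b := (O ~> a ~> a) ~> O ~> a) (closed (recα a)) x) y) m) (trc x y m).
Proof. unfold recα. rewrite closedE, !star_fnc. now autorewrite with sub. Qed.

(** * Compatibility of the translation with substitution *)

Notation atm := (alpha_tm interp).
Notation afm := (alpha_fm interp).

Lemma alpha_sub G G' D D' (v : asg G D) (v' : asg G' D') (s : sub G G') (s' : sub D D') :
  (forall a x, atm v' (s a x) = s' _ (v a x)) ->
  forall a t, atm v' (sub_tm (a := a) s t) = sub_tm s' (atm v t).
Proof.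
  intros h a t. induction t; cbn [sub_tm alpha_tm].
  - apply h.
  - now rewrite sub_closed.
  - now rewrite sub_star, IHt1, IHt2.
Qed.

Lemma alpha_wk G D (v : asg G D) b a (t : tm G a) :
  atm (up_asg (b := b) v) (wk t) = wk (atm v t).
Proof. rewrite !wkE. now apply alpha_sub. Qed.

Lemma alpha_sub_fm G (p : fm LH G) : forall G' D D' (v : asg G D) (v' : asg G' D')
    (s : sub G G') (s' : sub D D'),
  (forall a x, atm v' (s a x) = s' _ (v a x)) -> afm v' (sub_fm s p) = sub_fm s' (afm v p).
Proof.
  induction p; intros G' D D' v v' s s' hs; cbn [sub_fm alpha_fm];
    rewrite ?(alpha_sub hs); try (f_equal; eauto; fail).
  - now rewrite sub_dom.
  - cbn. rewrite sub_app, !up_wk. reflexivity.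
  - f_equal. apply IHp. apply var_case; [reflexivity|].
    intros c y. cbn. now rewrite alpha_wk, hs.
  - f_equal. apply IHp. apply var_case; [reflexivity|].
    intros c y. cbn. now rewrite alpha_wk, hs.
Qed.

Lemma alpha_wkf G D (v : asg G D) b (p : fm LH G) :
  afm (up_asg (b := b) v) (wkf p) = wkf (afm v p).
Proof. rewrite !wkfE. now apply alpha_sub_fm. Qed.

Lemma alpha_inst G D (v : asg G D) b (p : fm LH (b :: G)) t :
  afm v (inst p t) = inst (afm (up_asg v) p) (atm v t).
Proof. apply alpha_sub_fm. now apply var_case. Qed.

(** The translation sends [tsucc] to an application of [succα], which is provably equal to a
    successor but not syntactically one; this yields an equivalence in place of an identity. *)
Lemma alpha_succ_inst G D (v : asg G D) (p : fm LH (O :: G)) :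
  feq nil (afm (up_asg v) (succ_inst p)) (succ_inst (afm (up_asg v) p)).
Proof.
  unfold succ_inst. erewrite alpha_sub_fm with
    (s' := scons (star (a := O) (b := O) (closed succα) #0) (of_ren (shift O))).
  - apply sub_eqv. apply var_case; [apply succα_eq | reflexivity].
  - now apply var_case.
Qed.

(** The translation of hereditary equality: no observation separates [x] from [y]. *)
Definition nex G a (x y : tm G (plus a)) : fm LHA G :=
  Not (Ex (minus a) (app a (wk x) (wk y) #0)).

Lemma nexI G (H : list (fm LHA G)) a x y :
  (forall D (s : sub G D) H', wld s H H' -> forall z,
    H' ⊢ app a (sub_tm s x) (sub_tm s y) z -> H' ⊢ Bot) -> H ⊢ nex x y.
Proof.
  intros h. apply notI. intros H' l d. apply (exE d). intros D s H2 w z e.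
  autorewrite with sub in e. refine (h _ s _ _ z e).
  intros p f. apply w, l, f.
Qed.

Lemma nexE G (H : list (fm LHA G)) a (x y : tm G (plus a)) z q :
  H ⊢ nex x y -> H ⊢ app a x y z -> H ⊢ q.
Proof.
  intros d e. apply (notE _ d). apply exI with (t := z). now autorewrite with sub.
Qed.

Lemma sub_nex G D (s : sub G D) a (x y : tm G (plus a)) :
  sub_fm s (nex x y) = nex (sub_tm s x) (sub_tm s y).
Proof. unfold nex. cbn. now rewrite sub_app, !up_wk. Qed.
#[local] Hint Rewrite sub_nex : sub.

#[local] Instance nex_proper G H a :
  Proper (respectful (eqv H) (respectful (eqv H) (feq H))) (@nex G a).
Proof.
  assert (aux : forall x x' y y', eqv H x x' -> eqv H y y' -> H ⊢ @nex G a x y ==> nex x' y').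
  { intros x x' y y' d e. apply impI. intros H1 l f. apply nexI.
    intros D s H2 w z g. apply w in f. rewrite sub_nex in f.
    apply (eqv_later l) in d, e. apply (eqv_wld w) in d, e.
    rewrite <- d, <- e in g. exact (nexE _ f g). }
  intros x x' d y y' e. apply prv_andI; apply aux; (assumption || now symmetry).
Qed.

Lemma iffI G (H : list (fm LHA G)) p q :
  (forall H', later H H' -> H' ⊢ p -> H' ⊢ q) ->
  (forall H', later H H' -> H' ⊢ q -> H' ⊢ p) ->
  H ⊢ Iff p q.
Proof. intros h1 h2. apply prv_andI; now apply impI. Qed.

#[local] Instance And_proper G H :
  Proper (respectful (feq H) (respectful (feq H) (feq H))) (@And LHA G).
Proof.
  intros p p' d q q' e. apply iffI; intros H' l f; apply l in d, e; apply prv_andI;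
    apply prv_andE1 in f as f1; apply prv_andE2 in f as f2;
    eauto using prv_impE, prv_andE1, prv_andE2.
Qed.
#[local] Instance Iff_proper G H :
  Proper (respectful (feq H) (respectful (feq H) (feq H))) (@Iff LHA G).
Proof. intros p p' d q q' e. unfold Iff. now rewrite d, e. Qed.

(** At type [O] the absence of separating observations is a doubly negated equation, and numerical
    equality is stable. *)
Lemma nex_O G (H : list (fm LHA G)) (x y : tm G O) : H ⊢ Iff (nex (a := O) x y) (x == y).
Proof.
  apply iffI; intros H' l d.
  - apply eq_stable, notI. intros H2 l2 e. apply l2 in d.
    apply (nexE (a := O) (z := tzero) _ d), app_O_neq, e.
  - apply nexI. intros D s H2 w z e. apply w in d. exact (notE _ e d).
Qed.

Lemma nex_prod G (H : list (fm LHA G)) a b (x y : tm G (plus (a ** b))) :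
  H ⊢ Iff (nex x y) (nex (pfst x) (pfst y) && nex (psnd x) (psnd y)).
Proof.
  apply iffI; intros H' l d.
  - apply prv_andI; apply nexI; intros D s H2 w z e; apply w in d; sb;
      (eapply nexE; [exact d|]); [apply app_minl, e | apply app_minr, e].
  - apply nexI. intros D s H2 w z e.
    assert (d1 := w _ (prv_andE1 d)). assert (d2 := w _ (prv_andE2 d)). clear d. sb.
    apply app_prodE in e as [e1 e2].
    (* Agreement of the first components excludes a zero tag, so [z] must observe the second
       components, which agree as well. *)
    assert (e : H2 ⊢ Not (mtag z == tzero)).
    { apply notI. intros H3 l3 f. apply l3 in d1, e1. exact (nexE _ d1 (prv_impE e1 f)). }
    exact (nexE _ d2 (prv_impE e2 e)).
Qed.

Lemma nex_arr G (H : list (fm LHA G)) a b (x y : tm G (plus (a ~> b))) :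
  H ⊢ Iff (nex x y) (All (plus a) (dom a #0 ==> nex (star (wk x) #0) (star (wk y) #0))).
Proof.
  apply iffI; intros H' l d.
  - apply allI. intros D s H2 w u. apply w in d. sb. apply impI. intros H3 l3 du.
    apply l3 in d. apply nexI. intros E f H4 w4 z e. apply w4 in d, du. sb.
    (eapply nexE; [exact d|]). exact (app_arrI du e).
  - apply nexI. intros D s H2 w z e. apply app_arrE in e as [e1 e2].
    apply (allE_wld (afst z) w) in d. sb. exact (nexE _ (prv_impE d e1) e2).
Qed.

(** * Validity of the translated axioms and rules *)

Ltac as_eqv := match goal with |- prv _ ?H (Eqv ?x ?y) => change (eqv H x y) end.

Lemma alpha_HA_ax G (p : fm LH G) : HA_ax p -> forall D (v : asg G D) H, H ⊢ afm v p.
Proof.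
  destruct 1; intros D v H; cbn [alpha_fm alpha_tm interp Not].
  - apply prv_ax, ax_refl.
  - apply prv_ax, ax_sym.
  - apply prv_ax, ax_trans.
  - apply impI; intros H1 l1 d. apply impI; intros H2 l2 e. apply l2 in d.
    exact (star_proper d e).
  - apply kα_eq.
  - apply sα_eq.
  - as_eqv. etransitivity; [apply fstα_eq|]. etransitivity; [|apply pfst_pair].
    apply pfst_proper, pairα_eq.
  - as_eqv. etransitivity; [apply sndα_eq|]. etransitivity; [|apply psnd_pair].
    apply psnd_proper, pairα_eq.
  - as_eqv. etransitivity; [apply recα_eq|]. apply trc0.
  - as_eqv. etransitivity; [apply recα_eq|].
    etransitivity; [apply trc_proper; [reflexivity..|apply succα_eq]|].
    etransitivity; [apply trcS|]. apply star_proper; [reflexivity|]. symmetry. apply recα_eq.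
  - apply impI; intros H1 l1 d. refine (prv_impE (prv_ax _ (ax_succ_inj _ _ _)) _).
    as_eqv. etransitivity; [symmetry; apply succα_eq|]. etransitivity; [exact d | apply succα_eq].
  - apply notI; intros H1 l1 d. refine (notE _ (prv_ax _ (ax_succ_neq0 _ (atm v x))) _).
    as_eqv. etransitivity; [symmetry; apply succα_eq|]. exact d.
  - rewrite alpha_inst. apply impI; intros H1 l1 d. apply impI; intros H2 l2 e. apply l2 in d.
    eapply prv_impE; [eapply prv_impE; [apply prv_ax, ax_ind|exact d]|].
    apply allI. intros E s H3 w t. apply (allE_wld t w) in e.
    cbn [sub_fm] in *. apply impI; intros H4 l4 f. apply l4 in e.
    assert (g := prv_impE e f).
    (* The equivalence holds without hypotheses, so it can be carried along [s] and then weakened to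
       the present world. *)
    assert (h : nil ⊢ sub_fm (scons t s)
      (Iff (afm (up_asg v) (succ_inst p)) (succ_inst (afm (up_asg v) p)))).
    { apply (@prv_sub _ nil). apply alpha_succ_inst. }
    apply (prv_mono (H' := H4)) in h; [|intros ? []].
    exact (prv_impE (prv_andE1 h) g).
Qed.

Lemma alpha_HE_ax G (p : fm LH G) : HE_ax p -> forall D (v : asg G D) H, H ⊢ afm v p.
Proof.
  destruct 1 as [p d|a b f x y]; intros D v H.
  (* Extensionality is what the modulus provides: an observation separating the values of [f] is
     turned into one separating its arguments. *)
  2:{ change (H ⊢ dom (a ~> b) (atm v f) ==> dom a (atm v x) ==> dom a (atm v y) ==>
        nex (atm v x) (atm v y) ==> nex (star (atm v f) (atm v x)) (star (atm v f) (atm v y))).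
      apply impI; intros H1 l1 df. apply impI; intros H2 l2 dx. apply impI; intros H3 l3 dy.
      apply impI; intros H4 l4 d. apply nexI. intros E s H5 w z e.
      apply l2, l3, l4, w in df. apply l3, l4, w in dx. apply l4, w in dy. apply w in d. sb.
      exact (nexE _ d (dom_md df dx dy e)). }
  destruct d as [p d|x y| |a b x y|a b x|a b f g|a b f x|a x y|a c].
  - now apply alpha_HA_ax.
  - exact (nex_O H (atm v x) (atm v y)).
  - apply allI. intros. apply impI; intros; assumption.
  - change (H ⊢ Iff (nex (atm v x) (atm v y))
      (nex (star (a := a ** b) (closed (fstα a b)) (atm v x))
           (star (a := a ** b) (closed (fstα a b)) (atm v y)) &&
       nex (star (a := a ** b) (closed (sndα a b)) (atm v x))
           (star (a := a ** b) (closed (sndα a b)) (atm v y)))).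
    rewrite !fstα_eq, !sndα_eq. apply nex_prod.
  - change (H ⊢ Iff (dom (a ** b) (atm v x))
      (dom a (star (a := a ** b) (closed (fstα a b)) (atm v x)) &&
       dom b (star (a := a ** b) (closed (sndα a b)) (atm v x)))).
    rewrite fstα_eq, sndα_eq. apply feq_equiv.
  - change (H ⊢ Iff (nex (atm v f) (atm v g))
      (All (plus a) (dom a #0 ==> nex (star (atm (up_asg v) (wk f)) #0)
        (star (atm (up_asg v) (wk g)) #0)))).
    rewrite !alpha_wk. apply nex_arr.
  - change (H ⊢ dom (a ~> b) (atm v f) ==> dom a (atm v x) ==> dom b (star (atm v f) (atm v x))).
    apply impI; intros H1 l1 df. apply impI; intros H2 l2 dx. apply l2 in df.
    now apply dom_star.
  - change (H ⊢ atm v x == atm v y ==> dom a (atm v x) ==> dom a (atm v y)).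
    apply impI; intros H1 l1 e. apply impI; intros H2 l2 dx. apply l2 in e.
    change (eqv H2 (atm v x) (atm v y)) in e. now rewrite <- e.
  - apply dom_const.
Qed.

(** By induction on the derivation, for arbitrary hypotheses and assignments, because the quantifier
    rules weaken the former and extend the latter. *)
Lemma soundness G (H : list (fm LH G)) p : prv HE_ax H p ->
  forall D (v : asg G D), map (afm v) H ⊢ afm v p.
Proof.
  assert (wkH : forall G D (v : asg G D) b (H : list (fm LH G)),
    map (afm (up_asg (b := b) v)) (map wkf H) = map wkf (map (afm v) H)).
  { intros. rewrite !map_map. apply map_ext. intros. apply alpha_wkf. }
  induction 1; intros D v; cbn [alpha_fm map] in *.
  - now apply alpha_HE_ax.
  - now apply prv_hyp, in_map.
  - apply prv_botE. exact (IHprv _ v).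
  - apply prv_andI; auto.
  - eapply prv_andE1, IHprv.
  - eapply prv_andE2, IHprv.
  - apply prv_orI1; auto.
  - apply prv_orI2; auto.
  - eapply prv_orE; [apply IHprv1 | apply IHprv2 | apply IHprv3].
  - apply prv_impI, IHprv.
  - eapply prv_impE; [apply IHprv1 | apply IHprv2].
  - apply prv_allI. rewrite <- wkH. apply IHprv.
  - rewrite alpha_inst. apply prv_allE, IHprv.
  - apply prv_exI with (t := atm v t). rewrite <- alpha_inst. apply IHprv.
  - eapply prv_exE; [apply IHprv1|]. rewrite <- wkH, <- alpha_wkf. apply IHprv2.
Qed.

Theorem theorem5p5 :
  exists ca : const_interp,
  forall (G D : ctx) (v : asg G D), asg_injective v ->
  forall p : fm LH G, HE_prv p -> HA_prv (alpha_fm ca v p).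
Proof.
  exists interp. intros G D v _ p d. exact (soundness d v).
Qed.
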